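(* Let $H$ be an infinite-dimensional separable complex Hilbert space, let $X$ be a Hilbert space with $\dim X<\infty$, let $A \in C([0,1], L(H))$, $D \in C([0,1], L(X))$, and let $\theta>0$ be such that \[ W_e(A(t))\supset \{z\in\mathbb C:|z|\le \|D(t)\|+\theta\}, \qquad t\in[0,1]. \] Then there is a modulus of continuity $\delta$, depending only on $\theta$ and the moduli of continuity $\delta_A$ and $\delta_D$, such that for every closed subspace $L$ of $H$ with $\operatorname{codim} L<\infty$ there exists an isometry-valued function $V \in C([0,1], L(X,H))$ with $Z(V)\subset L$, admitting $\delta$ as a modulus of continuity (i.e. $\|V(t)-V(t')\|\le\delta(|t-t'|)$), and such that \[ V^*(t)A(t)V(t)=D(t), \qquad t \in [0,1]. \]
   Context: For $T\in L(H)$ the essential numerical range $W_e(T)$ is the set of all $\lambda\in\mathbb C$ for which there is an orthonormal sequence $(u_n)$ in $H$ with $\langle Tu_n,u_n\rangle\to\lambda$. $Z(V)=\bigvee_{t\in[0,1]}V(t)X$ (closed linear span of all ranges). A modulus of continuity is a non-decreasing $\delta:[0,\infty)\to[0,\infty)$ with $\delta(0)=\lim_{s\to0+}\delta(s)=0$; for continuous $f$ on $[0,1]$, $\delta_f(s)=\max\{\|f(t)-f(t')\|: |t-t'|\le s\}$. *)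

(* Defs.v *)
From mathcomp Require Import all_boot all_order all_algebra.
From mathcomp Require Import all_classical all_reals.
From mathcomp Require Import complex.
Set Implicit Arguments. Unset Strict Implicit. Unset Printing Implicit Defensive.
Import Order.TTheory GRing.Theory Num.Theory.
Local Open Scope ring_scope.
Local Open Scope classical_set_scope.

Record preHilbert (R : realType) := PreHilbert {
  hcar :> lmodType R[i];
  hdot : hcar -> hcar -> R[i];
  hdotDl : forall (a : R[i]) (x y z : hcar),
      hdot (a *: x + y) z = a * hdot x z + hdot y z;
  hdotC : forall x y : hcar, hdot y x = (hdot x y)^*;
  hdot_ge0 : forall x : hcar, 0 <= hdot x x;
  hdot_eq0 : forall x : hcar, hdot x x = 0 -> x = 0 }.

Section Hilbert.
Variable R : realType.

Definition hnorm (H : preHilbert R) (x : H) : R := Num.sqrt (complex.Re (hdot x x)).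

Definition hcvg (H : preHilbert R) (u : nat -> H) (l : H) : Prop :=
  forall e : R, 0 < e -> exists N : nat, forall n, (N <= n)%N -> hnorm (u n - l) < e.

Definition hcauchy (H : preHilbert R) (u : nat -> H) : Prop :=
  forall e : R, 0 < e -> exists N : nat, forall m n, (N <= m)%N -> (N <= n)%N ->
    hnorm (u m - u n) < e.

Definition complete (H : preHilbert R) : Prop :=
  forall u : nat -> H, hcauchy u -> exists l, hcvg u l.

Definition separable (H : preHilbert R) : Prop :=
  exists s : nat -> H, forall (x : H) (e : R), 0 < e -> exists n, hnorm (x - s n) < e.

Definition finite_dim (H : preHilbert R) : Prop :=
  exists (n : nat) (e : 'I_n -> H), forall x : H,
    exists c : 'I_n -> R[i], x = \sum_(i < n) c i *: e i.

Definition bounded_linear (H K : preHilbert R) (T : H -> K) : Prop :=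
  (forall (a : R[i]) (x y : H), T (a *: x + y) = a *: T x + T y) /\
  exists C : R, forall x : H, hnorm (T x) <= C * hnorm x.

Definition opnorm (H K : preHilbert R) (T : H -> K) : R :=
  sup [set hnorm (T x) | x in [set x : H | hnorm x <= 1]].

Definition unit_interval : set R := [set t | 0 <= t <= 1].

Definition cont_op_path (H K : preHilbert R) (T : R -> H -> K) : Prop :=
  (forall t, unit_interval t -> bounded_linear (T t)) /\
  forall t, unit_interval t -> forall e : R, 0 < e -> exists2 d : R, 0 < d &
    forall t', unit_interval t' -> `|t - t'| < d ->
      opnorm (fun x => T t x - T t' x) < e.

Definition op_modulus (H K : preHilbert R) (T : R -> H -> K) (s : R) : R :=
  sup [set opnorm (fun x => T tt.1 x - T tt.2 x) | tt in
        [set tt : R * R | unit_interval tt.1 /\ unit_interval tt.2 /\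
                          `|tt.1 - tt.2| <= s]].

Definition modulus_of_continuity (delta : R -> R) : Prop :=
  (forall s, 0 <= s -> 0 <= delta s) /\
  (forall s s', 0 <= s -> s <= s' -> delta s <= delta s') /\
  delta 0 = 0 /\
  (forall e : R, 0 < e -> exists2 d : R, 0 < d & forall s, 0 < s -> s < d -> delta s < e).

Definition orthonormal (H : preHilbert R) (u : nat -> H) : Prop :=
  forall m n, hdot (u m) (u n) = (if m == n then 1 else 0).

Definition ess_num_range (H : preHilbert R) (T : H -> H) : set R[i] :=
  [set lam | exists u : nat -> H, orthonormal u /\
     forall e : R, 0 < e -> exists N : nat, forall n, (N <= n)%N ->
       `|hdot (T (u n)) (u n) - lam| < (e%:C)%C].

Definition closed_subspace (H : preHilbert R) (L : set H) : Prop :=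
  L 0 /\ (forall x y, L x -> L y -> L (x + y)) /\
  (forall (a : R[i]) x, L x -> L (a *: x)) /\
  (forall (u : nat -> H) l, (forall n, L (u n)) -> hcvg u l -> L l).

Definition finite_codim (H : preHilbert R) (L : set H) : Prop :=
  exists (n : nat) (e : 'I_n -> H), forall h : H,
    exists2 l, L l & exists c : 'I_n -> R[i], h = l + \sum_(i < n) c i *: e i.

Definition closed_span (H : preHilbert R) (S : set H) : set H :=
  [set h | forall M : set H, closed_subspace M -> S `<=` M -> M h].

Definition Zspan (X H : preHilbert R) (V : R -> X -> H) : set H :=
  closed_span [set V t x | t in unit_interval & x in [set: X]].

Definition is_isometry (X H : preHilbert R) (V : X -> H) : Prop :=
  forall x y : X, hdot (V x) (V y) = hdot x y.

End Hilbert.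

(* Main.v *)
Require Import Defs.
From HB Require Import structures.
From mathcomp Require Import all_boot all_order all_algebra.
From mathcomp Require Import all_classical all_reals.
From mathcomp Require Import complex ring lra sesquilinear spectral.
Set Implicit Arguments. Unset Strict Implicit. Unset Printing Implicit Defensive.
Import Order.TTheory GRing.Theory Num.Theory.
Local Open Scope ring_scope.
Local Open Scope classical_set_scope.
Local Open Scope sesquilinear_scope.

(** Fix a grid of [0,1], fine with respect to both moduli, and a node t_i.  With
    r_i = |D(t_i)| + theta and tau = theta/(2 r_i), the matrix
    D(t_i)/(1 - tau) (+) r_i [[0,1],[0,0]] has norm at most r_i, so it is a
    compression of a diagonal matrix with entries of modulus r_i (Halmos), and
    these entries are approximately realised by orthonormal vectors of L.  This
    gives isometries w_i with orthogonal ranges in L which almost compress A(t_i)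
    to that matrix, with couplings between different i small uniformly in t.

    For K, S in L(X) put Y_i = w_i (sqrt(1 - tau), sqrt tau (1 + S), sqrt tau K).
    Then, up to small errors, Y_i^* A(t_i) Y_i = D(t_i) + theta/2 (1 + S)^* K, and
    Y_i is an isometry as soon as S = -(S^* S + K^* K)/2.  With a partition of
    unity (psi_i^2) set V(t) = sum_i psi_i(t) Y_i.  The exact equations
    V^* V = 1 and V^* A(t) V = D(t) become a fixed point problem for (S, K), which
    is a 1/2-contraction of a small ball in operator norm.  All constants are
    dimension free, and A enters only through its increments, never through its
    norm, so the modulus of the fixed point depends on theta, delta_A and delta_D
    only. *)

(** * Geometry of pre-Hilbert spaces, with moduli taken as real numbers *)

Section PreHilbertBasics.
Variable R : realType.
Local Notation C := R[i].
Implicit Types (H K : preHilbert R) (z : C) (r : R).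
Local Notation rc r := (real_complex R r).

(** The nilpotent block is what makes an exact solution possible: the derivative of theta/2 (1 +
    S)^* K at 0 is theta/2 times K, whatever D is, so every error that is small against theta can be
    absorbed by K. The weight is chosen so that tau_i r_i = theta/2 at every node: one pair (S, K)
    then serves all nodes, and the single factor k = 2/theta inverts the averaged equation.

    The obstacle is uniformity, since delta is fixed before L and dim X are known. It is built from
    theta, the two moduli and the number N of grid cells, and N is itself read off from theta and
    the moduli. The tolerance used in choosing the w_i does depend on dim X, but it is fixed after N
    and is replaced by theta in the final bounds. Norms of A and D are avoided in differences over t
    because the model blocks do not depend on t and because the psi_i^2 sum to 1, so that a constant
    matrix can be subtracted from the interpolated D.

    No continuous selection is needed: two parameters in the ball, solving the equations at t and
    t', differ by at most a multiple of the change in the data, so they may be chosen for each t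
    separately. *)

Definition cabs z : R := complex.Re `|z|.

Lemma cabsE z : `|z| = rc (cabs z).
Proof. by rewrite /cabs normc_def. Qed.

Lemma cabs_ge0 z : 0 <= cabs z.
Proof. by rewrite -ler0c -cabsE. Qed.

Lemma cabs_le z r : (cabs z <= r) = (`|z| <= rc r).
Proof. by rewrite cabsE lecR. Qed.

Lemma cabsM z1 z2 : cabs (z1 * z2) = cabs z1 * cabs z2.
Proof. by apply: (@complexI R); rewrite rmorphM /= -!cabsE normrM. Qed.

Lemma cabsD z1 z2 : cabs (z1 + z2) <= cabs z1 + cabs z2.
Proof. by rewrite -lecR rmorphD /= -!cabsE ler_normD. Qed.

Lemma cabsN z : cabs (- z) = cabs z.
Proof. by rewrite /cabs normrN. Qed.

Lemma cabs0 : cabs 0 = 0.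
Proof. by rewrite /cabs normr0. Qed.

Lemma cabsJ z : cabs z^* = cabs z.
Proof. by rewrite /cabs norm_conjC. Qed.

Lemma cabs_real r : cabs (rc r) = `|r|.
Proof. by rewrite /cabs normc_def /= expr0n addr0 sqrtr_sqr. Qed.

Lemma cabs_sum I (s : seq I) (P : pred I) (F : I -> C) :
  cabs (\sum_(i <- s | P i) F i) <= \sum_(i <- s | P i) cabs (F i).
Proof.
elim/big_ind2: _ => //; first by rewrite cabs0.
by move=> x1 x2 y1 y2 h1 h2; apply: le_trans (cabsD _ _) (lerD h1 h2).
Qed.

Lemma cabs_eq0 z : cabs z = 0 -> z = 0.
Proof. by move=> h; apply: normr0_eq0; rewrite cabsE h. Qed.

Lemma cabs_sqr z : rc (cabs z ^+ 2) = z * z^*.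
Proof. by rewrite rmorphXn /= -cabsE normCK. Qed.

Lemma Re_le_cabs z : complex.Re z <= cabs z.
Proof.
by apply: le_trans (ler_norm _) _; rewrite -lecR -cabsE; apply: normc_ge_Re.
Qed.

Lemma hdotD H (x y z : H) : hdot (x + y) z = hdot x z + hdot y z.
Proof. by have := hdotDl 1 x y z; rewrite scale1r mul1r. Qed.

Lemma hdot0l H (z : H) : hdot 0 z = 0.
Proof. by apply: (addIr (hdot 0 z)); rewrite -hdotD add0r add0r. Qed.

Lemma hdotZ H a (x z : H) : hdot (a *: x) z = a * hdot x z.
Proof. by have := hdotDl a x 0 z; rewrite hdot0l !addr0. Qed.

Lemma hdotN H (x z : H) : hdot (- x) z = - hdot x z.
Proof. by rewrite -scaleN1r hdotZ mulN1r. Qed.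

Lemma hdotB H (x y z : H) : hdot (x - y) z = hdot x z - hdot y z.
Proof. by rewrite hdotD hdotN. Qed.

Lemma hdotDr H (x y z : H) : hdot x (y + z) = hdot x y + hdot x z.
Proof. by rewrite hdotC hdotD rmorphD /= -!hdotC. Qed.

Lemma hdotZr H a (x z : H) : hdot x (a *: z) = a^* * hdot x z.
Proof. by rewrite hdotC hdotZ rmorphM /= -!hdotC. Qed.

Lemma hdot0r H (x : H) : hdot x 0 = 0.
Proof. by rewrite hdotC hdot0l rmorph0. Qed.

Lemma hdotBr H (x y z : H) : hdot x (y - z) = hdot x y - hdot x z.
Proof. by rewrite hdotC hdotB rmorphB /= -!hdotC. Qed.

Lemma hdot_suml H I (s : seq I) (P : pred I) (F : I -> H) (z : H) :
  hdot (\sum_(i <- s | P i) F i) z = \sum_(i <- s | P i) hdot (F i) z.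
Proof.
by elim/big_rec2: _ => [|i x y _ <-]; rewrite ?hdot0l ?hdotD.
Qed.

Lemma hdot_sumr H I (s : seq I) (P : pred I) (F : I -> H) (z : H) :
  hdot z (\sum_(i <- s | P i) F i) = \sum_(i <- s | P i) hdot z (F i).
Proof.
by elim/big_rec2: _ => [|i x y _ <-]; rewrite ?hdot0r ?hdotDr.
Qed.

Lemma Re_hdot_ge0 H (x : H) : 0 <= complex.Re (hdot x x).
Proof. by have := hdot_ge0 x; rewrite lecE /= => /andP[]. Qed.

Lemma hnorm_ge0 H (x : H) : 0 <= hnorm x.
Proof. exact: sqrtr_ge0. Qed.

Lemma hnorm_sqr H (x : H) : hnorm x ^+ 2 = complex.Re (hdot x x).
Proof. by rewrite sqr_sqrtr // Re_hdot_ge0. Qed.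

Lemma hdot_xx H (x : H) : hdot x x = rc (hnorm x ^+ 2).
Proof. by rewrite hnorm_sqr RRe_real // ger0_real // hdot_ge0. Qed.

Lemma hnorm_eqP H (x : H) r : 0 <= r -> hdot x x = rc (r ^+ 2) -> hnorm x = r.
Proof.
move=> r0; rewrite hdot_xx => /complexI /eqP.
by rewrite eqrXn2 ?hnorm_ge0 // => /eqP.
Qed.

Lemma hnorm_eq0 H (x : H) : hnorm x = 0 -> x = 0.
Proof. by move=> h; apply: hdot_eq0; rewrite hdot_xx h expr0n. Qed.

Lemma hnorm0 H : hnorm (0 : H) = 0.
Proof. by apply: hnorm_eqP => //; rewrite hdot0l expr0n. Qed.

Lemma hnormZ H a (x : H) : hnorm (a *: x) = cabs a * hnorm x.
Proof.
apply: hnorm_eqP; first by rewrite mulr_ge0 ?cabs_ge0 ?hnorm_ge0.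
by rewrite hdotZ hdotZr hdot_xx mulrA exprMn -cabs_sqr -rmorphM.
Qed.

Lemma hnormN H (x : H) : hnorm (- x) = hnorm x.
Proof. by rewrite -scaleN1r hnormZ cabsN cabs_real normr1 mul1r. Qed.

Lemma hdot_CS H (x y : H) : cabs (hdot x y) <= hnorm x * hnorm y.
Proof.
have [y0|y0] := eqVneq (hnorm y) 0.
  by rewrite (hnorm_eq0 y0) hdot0r cabs0 mulr_ge0 ?hnorm_ge0.
rewrite -(@ler_pXn2r _ 2) ?nnegrE ?mulr_ge0 ?cabs_ge0 ?hnorm_ge0 //.
have yp : 0 < hnorm y ^+ 2 by rewrite exprn_gt0 // lt_neqAle eq_sym y0 hnorm_ge0.
have yc : rc (hnorm y ^+ 2) != 0 by rewrite (inj_eq (@complexI R)) gt_eqF.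
set a := hdot x y / rc (hnorm y ^+ 2).
have aE : a^* = hdot y x / rc (hnorm y ^+ 2).
  by rewrite /a rmorphM fmorphV /= -hdotC conj_Creal // complex_real.
have := hdot_ge0 (x - a *: y).
have -> : hdot (x - a *: y) (x - a *: y) =
          rc (hnorm x ^+ 2 - cabs (hdot x y) ^+ 2 / hnorm y ^+ 2).
  have -> : forall p q s : R, 0 < s -> rc (p - q / s) = rc p - rc q / rc s.
    by move=> p q s s0; rewrite rmorphB rmorphM fmorphV.
  rewrite hdotB !hdotBr !hdotZ !hdotZr aE !hdot_xx // cabs_sqr.
    rewrite -hdotC /a [_ / _ * rc _]divfK // subrr subr0; congr (_ - _).
    by rewrite mulrAC [hdot y x * _]mulrC.
  by [].
by rewrite ler0c subr_ge0 ler_pdivrMr // exprMn.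
Qed.

Lemma hnormD H (x y : H) : hnorm (x + y) <= hnorm x + hnorm y.
Proof.
rewrite -(@ler_pXn2r _ 2) ?nnegrE ?addr_ge0 ?hnorm_ge0 //.
rewrite hnorm_sqr hdotD !hdotDr !hdot_xx (hdotC x y) !raddfD /=.
have h z : complex.Re z^* = complex.Re z by case: z.
rewrite h; have := hdot_CS x y; have := Re_le_cabs (hdot x y).
nra.
Qed.

Lemma hnormB H (x y : H) : hnorm (x - y) <= hnorm x + hnorm y.
Proof. by rewrite -(hnormN y) hnormD. Qed.

Lemma hnorm_sum H I (s : seq I) (P : pred I) (F : I -> H) :
  hnorm (\sum_(i <- s | P i) F i) <= \sum_(i <- s | P i) hnorm (F i).
Proof.
elim/big_ind2: _ => //; first by rewrite hnorm0.
by move=> x1 x2 y1 y2 h1 h2; apply: le_trans (hnormD _ _) (lerD h1 h2).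
Qed.

End PreHilbertBasics.

(** * Bounded operators and their norm *)

Section OperatorNorm.
Variable R : realType.
Implicit Types H K : preHilbert R.

Lemma bounded_linearD H K (T : H -> K) x y :
  bounded_linear T -> T (x + y) = T x + T y.
Proof. by move=> [lin _]; have := lin 1 x y; rewrite !scale1r. Qed.

Lemma bounded_linear0 H K (T : H -> K) : bounded_linear T -> T 0 = 0.
Proof.
by move=> bT; apply: (addIr (T 0)); rewrite -(bounded_linearD _ _ bT) !add0r.
Qed.

Lemma bounded_linearZ H K (T : H -> K) a x :
  bounded_linear T -> T (a *: x) = a *: T x.
Proof.
by move=> bT; have := bT.1 a x 0; rewrite (bounded_linear0 bT) !addr0.
Qed.

Lemma bounded_linear_sum H K (T : H -> K) I (s : seq I) (P : pred I) F :
  bounded_linear T ->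
  T (\sum_(i <- s | P i) F i) = \sum_(i <- s | P i) T (F i).
Proof.
move=> bT; elim/big_rec2: _ => [|i x y _ <-]; first exact: bounded_linear0.
exact: bounded_linearD.
Qed.

Lemma bounded_linearB H K (S T : H -> K) :
  bounded_linear S -> bounded_linear T -> bounded_linear (fun x => S x - T x).
Proof.
move=> [linS [c hc]] [linT [d hd]]; split=> [a x y|].
  rewrite linS linT scalerBr opprD !addrA; congr (_ + _).
  by rewrite -!addrA; congr (_ + _); rewrite addrC.
exists (c + d) => x; rewrite mulrDl; apply: le_trans (hnormB _ _) _.
exact: lerD.
Qed.

Lemma opnorm_le H K (T : H -> K) (c : R) :
  (forall x, hnorm (T x) <= c * hnorm x) -> 0 <= c -> opnorm T <= c.
Proof.
move=> hT c0; apply: ge_sup.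
  by exists (hnorm (T 0)), 0 => //=; rewrite hnorm0.
move=> _ [x /= x1 <-]; apply: le_trans (hT x) _.
by rewrite -[leRHS]mulr1 ler_wpM2l.
Qed.

Lemma opnorm_has_ub H K (T : H -> K) : bounded_linear T ->
  has_ubound [set hnorm (T x) | x in [set x : H | hnorm x <= 1]].
Proof.
move=> [_ [c hc]]; exists `|c| => _ [x /= x1 <-]; apply: le_trans (hc x) _.
apply: le_trans (ler_norm _) _.
by rewrite normrM -[leRHS]mulr1 ler_wpM2l // ger0_norm // hnorm_ge0.
Qed.

Lemma opnorm_ge0 H K (T : H -> K) : bounded_linear T -> 0 <= opnorm T.
Proof.
move=> bT; apply: ub_le_sup; first exact: opnorm_has_ub.
by exists 0; rewrite /= ?hnorm0 // (bounded_linear0 bT) hnorm0.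
Qed.

Lemma opnorm_ub H K (T : H -> K) x : bounded_linear T ->
  hnorm (T x) <= opnorm T * hnorm x.
Proof.
move=> bT; have [x0|x0] := eqVneq (hnorm x) 0.
  by rewrite (hnorm_eq0 x0) (bounded_linear0 bT) !hnorm0 mulr0.
have xp : 0 < hnorm x by rewrite lt_neqAle eq_sym x0 hnorm_ge0.
rewrite -ler_pdivrMr // mulrC.
have vp : 0 <= (hnorm x)^-1 by rewrite invr_ge0 ltW.
rewrite -[X in X * _]ger0_norm // -cabs_real -hnormZ -bounded_linearZ //.
apply: ub_le_sup; first exact: opnorm_has_ub.
by eexists; last by []; rewrite /= hnormZ cabs_real ger0_norm // mulVf.
Qed.

Lemma opnormB_sym H K (S T : H -> K) :
  opnorm (fun x => S x - T x) = opnorm (fun x => T x - S x).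
Proof.
congr sup; apply/seteqP; split=> _ [x hx <-]; exists x => //;
by rewrite -hnormN opprB.
Qed.

Lemma opnormB_triangle H K (S T U : H -> K) :
  bounded_linear S -> bounded_linear T -> bounded_linear U ->
  opnorm (fun x => S x - U x) <=
    opnorm (fun x => S x - T x) + opnorm (fun x => T x - U x).
Proof.
move=> bS bT bU; apply: opnorm_le => [x|]; last first.
  by rewrite addr_ge0 ?opnorm_ge0 //; exact: bounded_linearB.
rewrite -[S x](subrK (T x)) -addrA mulrDl; apply: le_trans (hnormD _ _) _.
by apply: lerD; apply: (opnorm_ub (T := fun x => _ x - _ x));
  apply: bounded_linearB.
Qed.

End OperatorNorm.

(** * The Hermitian space of column vectors *)

Section Vectors.
Variable R : realType.
Local Notation C := R[i].
Local Notation rc r := (real_complex R r).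

Definition cdot n (x y : 'cV[C]_n) : C := \sum_a x a 0 * (y a 0)^*.

Lemma cdotDl n (a : C) (x y z : 'cV[C]_n) :
  cdot (a *: x + y) z = a * cdot x z + cdot y z.
Proof.
rewrite /cdot mulr_sumr -big_split; apply: eq_bigr => i _ /=.
by rewrite !mxE mulrDl mulrA.
Qed.

Lemma cdotC n (x y : 'cV[C]_n) : cdot y x = (cdot x y)^*.
Proof.
rewrite /cdot rmorph_sum; apply: eq_bigr => i _ /=.
by rewrite rmorphM /= conjCK mulrC.
Qed.

Lemma cdot_ge0 n (x : 'cV[C]_n) : 0 <= cdot x x.
Proof. by apply: sumr_ge0 => i _; rewrite mul_conjC_ge0. Qed.

Lemma cdot_eq0 n (x : 'cV[C]_n) : cdot x x = 0 -> x = 0.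
Proof.
move=> /eqP; rewrite psumr_eq0 => [/allP h|i _]; last by rewrite mul_conjC_ge0.
apply/matrixP => i j; rewrite ord1 mxE; apply/eqP.
by rewrite -mul_conjC_eq0; apply: h; rewrite mem_index_enum.
Qed.

Definition Cn n : preHilbert R :=
  PreHilbert (@cdotDl n) (@cdotC n) (@cdot_ge0 n) (@cdot_eq0 n).

Definition vnorm n (x : 'cV[C]_n) : R := hnorm (x : Cn n).

End Vectors.

(** Locked, so that it is handled only through [mulmx_ub], [mxnorm_ge0] and [mxnorm_le], which
    characterise it as the least Lipschitz constant for the Euclidean norms. *)
HB.lock Definition mxnorm (R : realType) m n (M : 'M[R[i]]_(m, n)) : R :=
  opnorm (fun x : Cn R n => M *m x : Cn R m).

(** * Adjoints and operator norms of complex matrices *)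

Section MatrixNorm.
Variable R : realType.
Local Notation C := R[i].
Local Notation rc r := (real_complex R r).
Local Notation Cn := (Cn R).

Lemma cdotE n (x y : 'cV[C]_n) : cdot x y = (y^t* *m x) 0 0.
Proof. by rewrite mxE; apply: eq_bigr => i _; rewrite !mxE mulrC. Qed.

Lemma trmxC_mul m n p (A : 'M[C]_(m, n)) (B : 'M[C]_(n, p)) :
  (A *m B)^t* = B^t* *m A^t*.
Proof. by rewrite trmx_mul map_mxM. Qed.

Lemma trmxCD m n (A B : 'M[C]_(m, n)) : (A + B)^t* = A^t* + B^t*.
Proof. by apply/matrixP => i j; rewrite !mxE rmorphD. Qed.

Lemma trmxCN m n (A : 'M[C]_(m, n)) : (- A)^t* = - A^t*.
Proof. by apply/matrixP => i j; rewrite !mxE rmorphN. Qed.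

Lemma trmxCZ m n a (A : 'M[C]_(m, n)) : (a *: A)^t* = a^* *: A^t*.
Proof. by apply/matrixP => i j; rewrite !mxE rmorphM. Qed.

Lemma trmxC1 n : (1%:M : 'M[C]_n)^t* = 1%:M.
Proof. by rewrite trmx1 map_mx1. Qed.

Lemma cdot_adj m n (M : 'M[C]_(m, n)) x y :
  cdot (M *m x) y = cdot x (M^t* *m y).
Proof. by rewrite !cdotE trmxC_mul trmxCK mulmxA. Qed.

Lemma cdot_isom m n (M : 'M[C]_(m, n)) x y :
  M^t* *m M = 1%:M -> cdot (M *m x) (M *m y) = cdot x y.
Proof. by move=> h; rewrite cdot_adj mulmxA h mul1mx. Qed.

Lemma vnorm_sqr n (x : 'cV[C]_n) : rc (vnorm x ^+ 2) = cdot x x.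
Proof. by rewrite -(@hdot_xx _ (Cn n)). Qed.

Lemma vnormE n (x : 'cV[C]_n) : vnorm x ^+ 2 = \sum_a cabs (x a 0) ^+ 2.
Proof.
apply: (@complexI R); rewrite vnorm_sqr rmorph_sum; apply: eq_bigr => i _ /=.
by rewrite cabs_sqr.
Qed.

Lemma vnorm_ge0 n (x : 'cV[C]_n) : 0 <= vnorm x.
Proof. exact: hnorm_ge0. Qed.

Lemma vnorm_isom m n (M : 'M[C]_(m, n)) x :
  M^t* *m M = 1%:M -> vnorm (M *m x) = vnorm x.
Proof.
by move=> h; apply: hnorm_eqP; rewrite ?vnorm_ge0 // vnorm_sqr; apply: cdot_isom.
Qed.

Lemma vnorm_entry n (x : 'cV[C]_n) a : cabs (x a 0) <= vnorm x.
Proof.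
rewrite -(@ler_pXn2r _ 2) ?nnegrE ?cabs_ge0 ?vnorm_ge0 // vnormE (bigD1 a) //=.
by rewrite lerDl sumr_ge0 // => i _; rewrite exprn_ge0 // cabs_ge0.
Qed.

Lemma vnorm_le_sum n (x : 'cV[C]_n) : vnorm x <= \sum_a cabs (x a 0).
Proof.
have -> : x = \sum_a x a 0 *: delta_mx a 0.
  apply/matrixP => i j; rewrite summxE ord1 (bigD1 i) //= big1 => [|k ki].
    by rewrite !mxE !eqxx mulr1 addr0.
  by rewrite !mxE eq_sym (negbTE ki) mulr0.
have h (a : 'I_n) : (\sum_a0 x a0 0 *: delta_mx a0 0 : 'cV[C]_n) a 0 = x a 0.
  rewrite summxE (bigD1 a) //= big1 => [|k ki].
    by rewrite !mxE !eqxx mulr1 addr0.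
  by rewrite !mxE eq_sym (negbTE ki) mulr0.
under [leRHS]eq_bigr do rewrite h.
apply: le_trans (@hnorm_sum _ (Cn n) _ _ _ _) _.
apply: ler_sum => i _; rewrite hnormZ.
rewrite -[leRHS]mulr1 ler_wpM2l ?cabs_ge0 // le_eqVlt; apply/orP; left; apply/eqP.
apply: hnorm_eqP => //; rewrite /= /cdot (bigD1 i) //= big1 => [|k ki].
  by rewrite !mxE !eqxx /= conjC1 mul1r addr0 expr1n.
by rewrite !mxE (negbTE ki) mul0r.
Qed.

Lemma mx_entry_ub m n (M : 'M[C]_(m, n)) (x : 'cV[C]_n) :
  vnorm (M *m x) <= (\sum_i \sum_j cabs (M i j)) * vnorm x.
Proof.
apply: le_trans (vnorm_le_sum _) _; rewrite mulr_suml; apply: ler_sum => i _.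
rewrite mxE; apply: le_trans (cabs_sum _ _ _) _.
rewrite mulr_suml; apply: ler_sum => j _; rewrite cabsM.
by rewrite ler_wpM2l ?cabs_ge0 // vnorm_entry.
Qed.

Lemma mx_bounded_linear m n (M : 'M[C]_(m, n)) :
  bounded_linear (fun x : Cn n => M *m x : Cn m).
Proof.
split=> [a x y|]; first by rewrite mulmxDr -scalemxAr.
by exists (\sum_i \sum_j cabs (M i j)) => x; apply: mx_entry_ub.
Qed.

Lemma mulmx_ub m n (M : 'M[C]_(m, n)) x : vnorm (M *m x) <= mxnorm M * vnorm x.
Proof. rewrite mxnorm.unlock; exact: (@opnorm_ub _ (Cn n) (Cn m) _ x (mx_bounded_linear M)). Qed.

Lemma mxnorm_ge0 m n (M : 'M[C]_(m, n)) : 0 <= mxnorm M.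
Proof. rewrite mxnorm.unlock; exact: (@opnorm_ge0 _ (Cn n) (Cn m) _ (mx_bounded_linear M)). Qed.

Lemma mxnorm_le m n (M : 'M[C]_(m, n)) c :
  0 <= c -> (forall x, vnorm (M *m x) <= c * vnorm x) -> mxnorm M <= c.
Proof. by move=> c0 h; rewrite mxnorm.unlock; apply: opnorm_le. Qed.

Lemma mxnorm_entries m n (M : 'M[C]_(m, n)) :
  mxnorm M <= \sum_i \sum_j cabs (M i j).
Proof.
apply: mxnorm_le; last exact: mx_entry_ub.
by apply: sumr_ge0 => i _; apply: sumr_ge0 => j _; apply: cabs_ge0.
Qed.

Lemma entry_le_mxnorm m n (M : 'M[C]_(m, n)) i j : cabs (M i j) <= mxnorm M.
Proof.
have -> : M i j = (M *m delta_mx j 0 : 'cV_m) i 0.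
  rewrite mxE (bigD1 j) //= big1 => [|k kj]; first by rewrite !mxE !eqxx mulr1 addr0.
  by rewrite !mxE (negbTE kj) mulr0.
apply: le_trans (vnorm_entry _ _) _; apply: le_trans (mulmx_ub _ _) _.
rewrite -[leRHS]mulr1 ler_wpM2l ?mxnorm_ge0 //.
apply: le_trans (vnorm_le_sum _) _; rewrite (bigD1 j) //= big1 => [|k kj].
  by rewrite !mxE !eqxx cabs_real normr1 addr0.
by rewrite !mxE (negbTE kj) cabs0.
Qed.

Lemma mxnormD m n (A B : 'M[C]_(m, n)) : mxnorm (A + B) <= mxnorm A + mxnorm B.
Proof.
apply: mxnorm_le => [|x]; first by rewrite addr_ge0 ?mxnorm_ge0.
rewrite mulmxDl mulrDl; apply: le_trans (@hnormD _ (Cn m) _ _) _.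
by apply: lerD; apply: mulmx_ub.
Qed.

Lemma mxnormZ m n a (A : 'M[C]_(m, n)) : mxnorm (a *: A) <= cabs a * mxnorm A.
Proof.
apply: mxnorm_le => [|x]; first by rewrite mulr_ge0 ?mxnorm_ge0 ?cabs_ge0.
rewrite -scalemxAl -mulrA /vnorm hnormZ ler_wpM2l ?cabs_ge0 //.
exact: mulmx_ub.
Qed.

Lemma mxnormN m n (A : 'M[C]_(m, n)) : mxnorm (- A) <= mxnorm A.
Proof.
by rewrite -scaleN1r; apply: le_trans (mxnormZ _ _) _; rewrite cabsN cabs_real normr1 mul1r.
Qed.

Lemma mxnormB m n (A B : 'M[C]_(m, n)) : mxnorm (A - B) <= mxnorm A + mxnorm B.
Proof. by apply: le_trans (mxnormD _ _) _; rewrite lerD2l mxnormN. Qed.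

Lemma mxnormM m n p (A : 'M[C]_(m, n)) (B : 'M[C]_(n, p)) :
  mxnorm (A *m B) <= mxnorm A * mxnorm B.
Proof.
apply: mxnorm_le => [|x]; first by rewrite mulr_ge0 ?mxnorm_ge0.
rewrite -mulmxA -mulrA; apply: le_trans (mulmx_ub _ _) _.
by rewrite ler_wpM2l ?mxnorm_ge0 ?mulmx_ub.
Qed.

Lemma mxnormM_le m n p (A : 'M[C]_(m, n)) (B : 'M[C]_(n, p)) a b :
  mxnorm A <= a -> mxnorm B <= b -> mxnorm (A *m B) <= a * b.
Proof.
by move=> hA hB; apply: le_trans (mxnormM _ _) _; rewrite ler_pM ?mxnorm_ge0.
Qed.

Lemma mxnorm0 m n : mxnorm (0 : 'M[C]_(m, n)) = 0.
Proof.
apply/eqP; rewrite eq_le mxnorm_ge0 andbT; apply: mxnorm_le => // x.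
by rewrite mul0mx mul0r /vnorm hnorm0.
Qed.

Lemma mxnorm_sum m n I (s : seq I) (P : pred I) (F : I -> 'M[C]_(m, n)) :
  mxnorm (\sum_(i <- s | P i) F i) <= \sum_(i <- s | P i) mxnorm (F i).
Proof.
elim/big_ind2: _ => //; first by rewrite mxnorm0.
by move=> x1 x2 y1 y2 h1 h2; apply: le_trans (mxnormD _ _) (lerD h1 h2).
Qed.

(** |A^* x|^2 = <A A^* x, x> is at most |A| |A^* x| |x|, and one factor |A^* x| cancels. *)
Lemma mxnorm_adj m n (A : 'M[C]_(m, n)) : mxnorm (A^t*) <= mxnorm A.
Proof.
apply: mxnorm_le => [|x]; first exact: mxnorm_ge0.
have [->|v0] := eqVneq (vnorm (A^t* *m x)) 0.
  by rewrite mulr_ge0 ?mxnorm_ge0 ?vnorm_ge0.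
have vp : 0 < vnorm (A^t* *m x) by rewrite lt_neqAle eq_sym v0 vnorm_ge0.
rewrite -(ler_pM2r vp) -expr2.
have -> : vnorm (A^t* *m x) ^+ 2 = cabs (rc (vnorm (A^t* *m x) ^+ 2)).
  by rewrite cabs_real ger0_norm // exprn_ge0 // ltW.
rewrite vnorm_sqr -cdot_adj.
apply: le_trans (@hdot_CS _ (Cn m) _ _) _.
by rewrite mulrAC ler_wpM2r ?vnorm_ge0 // mulmx_ub.
Qed.

Lemma mxnorm_isom m n (M : 'M[C]_(m, n)) : M^t* *m M = 1%:M -> mxnorm M <= 1.
Proof. by move=> h; apply: mxnorm_le => // x; rewrite vnorm_isom // mul1r. Qed.

Lemma vnorm_col m n (x : 'cV[C]_m) (y : 'cV[C]_n) :
  vnorm (col_mx x y) ^+ 2 = vnorm x ^+ 2 + vnorm y ^+ 2.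
Proof.
rewrite !vnormE big_split_ord /=.
by congr (_ + _); apply: eq_bigr => i _; rewrite (col_mxEu, col_mxEd).
Qed.

Lemma mxnorm_col m1 m2 n (A : 'M[C]_(m1, n)) (B : 'M[C]_(m2, n)) :
  mxnorm (col_mx A B) <= mxnorm A + mxnorm B.
Proof.
apply: mxnorm_le => [|x]; first by rewrite addr_ge0 ?mxnorm_ge0.
rewrite mul_col_mx -(@ler_pXn2r _ 2) ?nnegrE ?mulr_ge0 ?addr_ge0 ?vnorm_ge0 ?mxnorm_ge0 //.
rewrite vnorm_col mulrDl.
have hA := mulmx_ub A x; have hB := mulmx_ub B x.
have := vnorm_ge0 (A *m x); have := vnorm_ge0 (B *m x).
set a := vnorm (A *m x) in hA *; set b := vnorm (B *m x) in hB *.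
set c := mxnorm A * _ in hA *; set d := mxnorm B * _ in hB *.
by move=> b0 a0; nra.
Qed.

Lemma mxnorm_usub m1 m2 n (A : 'M[C]_(m1 + m2, n)) : mxnorm (usubmx A) <= mxnorm A.
Proof.
apply: mxnorm_le => [|x]; first exact: mxnorm_ge0.
apply: le_trans (mulmx_ub A x).
rewrite -(@ler_pXn2r _ 2) ?nnegrE ?vnorm_ge0 // -[in leRHS](vsubmxK A) mul_col_mx.
by rewrite vnorm_col lerDl exprn_ge0 ?vnorm_ge0.
Qed.

Lemma mxnorm_dsub m1 m2 n (A : 'M[C]_(m1 + m2, n)) : mxnorm (dsubmx A) <= mxnorm A.
Proof.
apply: mxnorm_le => [|x]; first exact: mxnorm_ge0.
apply: le_trans (mulmx_ub A x).
rewrite -(@ler_pXn2r _ 2) ?nnegrE ?vnorm_ge0 // -[in leRHS](vsubmxK A) mul_col_mx.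
by rewrite vnorm_col lerDr exprn_ge0 ?vnorm_ge0.
Qed.

End MatrixNorm.

(** * Unitary dilation of contractions and diagonalization *)

Section UnitaryDilation.
Variable R : realType.
Local Notation C := R[i].
Local Notation rc r := (real_complex R r).

(** The eigenvalue of B^* B at a unit eigenvector v is |B v|^2, which makes it real and at most
    1. *)
Lemma gram_spectral p m (B : 'M[C]_(p, m)) : mxnorm B <= 1 ->
  exists (P : 'M[C]_m) (d : 'rV[R]_m),
    [/\ P *m P^t* = 1%:M, P^t* *m P = 1%:M,
        B^t* *m B = P^t* *m diag_mx (map_mx (real_complex R) d) *m P
      & forall k, d 0 k <= 1].
Proof.
move=> B1; set G := B^t* *m B; set P := spectralmx G; set D := spectral_diag G.
have PP : P *m P^t* = 1%:M by apply/unitarymxP/spectral_unitarymx.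
have PP' : P^t* *m P = 1%:M by apply: mulmx1C.
have Gn : G \is normalmx by apply/normalmxP; rewrite /G !trmxC_mul trmxCK.
have GE : G = P^t* *m diag_mx D *m P.
  rewrite -invmx_unitary; last exact: spectral_unitarymx.
  exact/orthomx_spectralP.
have Dk k : D 0 k = rc (vnorm (B *m (P^t* *m delta_mx k 0)) ^+ 2).
  rewrite vnorm_sqr cdotE !trmxC_mul trmxCK -!mulmxA.
  have -> : B^t* *m (B *m (P^t* *m delta_mx k 0)) = G *m (P^t* *m delta_mx k 0 : 'cV_m).
    by rewrite /G -!mulmxA.
  rewrite GE -!mulmxA [P *m (P^t* *m _)]mulmxA PP mul1mx [P *m (P^t* *m _)]mulmxA PP mul1mx.
  rewrite mxE (bigD1 k) //= big1 => [|j jk].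
    rewrite !mxE !eqxx /= conjC1 mul1r addr0 (bigD1 k) //= big1 => [|j jk].
      by rewrite !mxE !eqxx mulr1 addr0.
    by rewrite !mxE (negbTE jk) mulr0.
  by rewrite !mxE (negbTE jk) /= conjC0 mul0r.
exists P, (\row_k vnorm (B *m (P^t* *m delta_mx k 0)) ^+ 2); split.
- exact: PP.
- exact: PP'.
- rewrite GE; congr (_ *m diag_mx _ *m _); apply/matrixP => i k.
  by rewrite ord1 !mxE -Dk.
move=> k; rewrite mxE exprn_ile1 ?vnorm_ge0 //; apply: le_trans (mulmx_ub _ _) _; apply: mulr_ile1 => //; rewrite ?mxnorm_ge0 ?vnorm_ge0 //.
rewrite vnorm_isom ?trmxCK //; apply: le_trans (vnorm_le_sum _) _.
rewrite (bigD1 k) //= big1 => [|j jk]; first by rewrite !mxE !eqxx cabs_real normr1 addr0.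
by rewrite !mxE (negbTE jk) cabs0.
Qed.

(** Entrywise the hypothesis says that B i j can be nonzero only where d i = d' j, and there f d i =
    f d' j as well. This is the functional calculus needed for square roots. *)
Lemma diag_mx_intertwine p m (d : 'rV[R]_p) (d' : 'rV[R]_m) (B : 'M[C]_(p, m)) (f : R -> R) :
  let toC := fun k (e : 'rV[R]_k) => map_mx (real_complex R) e in
  diag_mx (toC p d) *m B = B *m diag_mx (toC m d') ->
  diag_mx (toC p (map_mx f d)) *m B = B *m diag_mx (toC m (map_mx f d')).
Proof.
move=> toC h; apply/matrixP => i j.
have := congr1 (fun M : 'M[C]_(p, m) => M i j) h.
rewrite !mul_diag_mx !mul_mx_diag !mxE mulrC => /eqP.
rewrite -subr_eq0 -mulrBr mulf_eq0 subr_eq0 => /orP[/eqP ->|/eqP/complexI ->].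
  by rewrite mulr0 mul0r.
by rewrite mulrC.
Qed.

Lemma unconj_intertwine m (P P' Q Q' T T' d e : 'M[C]_m) :
  P *m P' = 1%:M -> Q *m Q' = 1%:M ->
  T' *m T = P' *m d *m P -> T *m T' = Q' *m e *m Q ->
  d *m (P *m T' *m Q') = P *m T' *m Q' *m e.
Proof.
move=> PP QQ GE GE'; have := congr1 (fun M => P *m (M *m T') *m Q') GE.
have -> : T' *m T *m T' = T' *m (T *m T') by rewrite mulmxA.
rewrite GE' -!mulmxA QQ mulmx1 [P *m (P' *m _)]mulmxA PP mul1mx.
by move=> <-.
Qed.

Lemma conj_intertwine m (P P' Q Q' B d e : 'M[C]_m) :
  P' *m P = 1%:M -> Q' *m Q = 1%:M ->
  d *m (P *m B *m Q') = P *m B *m Q' *m e ->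
  P' *m d *m P *m B = B *m (Q' *m e *m Q).
Proof.
move=> PP QQ h; have := congr1 (fun M => P' *m M *m Q) h.
rewrite -!mulmxA QQ mulmx1 [P' *m (P *m _)]mulmxA PP mul1mx => h2.
by rewrite -h2.
Qed.

(** T^* T T^* can be read in two ways: T^* intertwines T T^* with T^* T, hence also the square roots
    of 1 minus these matrices. Both roots are taken in an eigenbasis, where the bound on T makes 1
    minus each eigenvalue nonnegative. *)
Lemma defect_operators m (T : 'M[C]_m) : mxnorm T <= 1 ->
  exists D D' : 'M[C]_m,
    [/\ D^t* = D, D'^t* = D', D *m D = 1%:M - T^t* *m T,
        D' *m D' = 1%:M - T *m T^t* & D *m T^t* = T^t* *m D'].
Proof.
move=> T1; have T1' : mxnorm (T^t*) <= 1 by apply: le_trans (mxnorm_adj _) T1.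
have [P [d [PP PP' GE d1]]] := gram_spectral T1.
have [Q [e [QQ QQ' GE' e1]]] := gram_spectral T1'.
rewrite trmxCK in GE'.
pose f (x : R) := Num.sqrt (1 - x).
pose D := P^t* *m diag_mx (map_mx (real_complex R) (map_mx f d)) *m P.
pose D' := Q^t* *m diag_mx (map_mx (real_complex R) (map_mx f e)) *m Q.
have sq k (W : 'M[C]_k) (c : 'rV[R]_k) : W *m W^t* = 1%:M -> W^t* *m W = 1%:M ->
    (forall j, c 0 j <= 1) ->
    W^t* *m diag_mx (map_mx (real_complex R) (map_mx f c)) *m W *m
    (W^t* *m diag_mx (map_mx (real_complex R) (map_mx f c)) *m W) =
    1%:M - W^t* *m diag_mx (map_mx (real_complex R) c) *m W.
  move=> WW WW' c1.
  rewrite -!mulmxA [W *m (W^t* *m _)]mulmxA WW mul1mx [diag_mx _ *m (diag_mx _ *m _)]mulmxA mulmx_diag.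
  rewrite -[in RHS]WW' -mulmxBr -[X in X - _]mul1mx -mulmxBl.
  congr (_ *m (_ *m _)); apply/matrixP => i j; rewrite !mxE.
  case: eqP => [->|_]; last by rewrite !mulr0n subr0.
  by rewrite !mulr1n -rmorphM /= -expr2 sqr_sqrtr ?subr_ge0 // rmorphB rmorph1.
have her k (W : 'M[C]_k) (c : 'rV[R]_k) :
    (W^t* *m diag_mx (map_mx (real_complex R) c) *m W)^t* =
    W^t* *m diag_mx (map_mx (real_complex R) c) *m W.
  rewrite !trmxC_mul trmxCK -mulmxA; congr (_ *m (_ *m _)).
  rewrite tr_diag_mx map_diag_mx; congr diag_mx; apply/matrixP => i j.
  by rewrite !mxE; apply: conj_Creal; rewrite complex_real.
have DD : D *m D = 1%:M - T^t* *m T by rewrite /D sq // -GE.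
have DD' : D' *m D' = 1%:M - T *m T^t* by rewrite /D' sq // -GE'.
have Dh : D^t* = D by apply: her.
have Dh' : D'^t* = D' by apply: her.
have com : D *m T^t* = T^t* *m D'.
  apply: (conj_intertwine PP' QQ'); apply: diag_mx_intertwine.
  exact: (unconj_intertwine PP QQ GE GE').
exists D, D'; split => //.
Qed.

(* Halmos: with D = (1 - T^* T)^(1/2) and D' = (1 - T T^* )^(1/2), the block
   matrix [[T, D'], [D, - T^* ]] is unitary, hence unitarily diagonalizable. *)
Lemma contraction_dilation m (T : 'M[C]_m) : mxnorm T <= 1 ->
  exists (U : 'M[C]_(m + m, m)) (lam : 'rV[C]_(m + m)),
    [/\ U^t* *m U = 1%:M, U^t* *m diag_mx lam *m U = T
      & forall k, `|lam 0 k| = 1].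
Proof.
move=> T1; have [D [D' [Dh Dh' DD DD' com]]] := defect_operators T1.
have com' : T *m D = D' *m T.
  by rewrite -{1}[T]trmxCK -{1}Dh -trmxC_mul com trmxC_mul trmxCK Dh'.
pose N := block_mx T D' D (- T^t*).
have NN : N^t* *m N = 1%:M.
  have -> : N^t* = block_mx (T^t*) D D' (- T).
    by rewrite /N tr_block_mx map_block_mx Dh Dh' trmxCN trmxCK.
  rewrite /N mulmx_block DD DD' [D *m _]mulmxN com subrr !mulNmx com' subrr.
  by rewrite mulmxN opprK [T^t* *m T + _]addrC !subrK -scalar_mx_block.
have NN' : N *m N^t* = 1%:M by apply: mulmx1C.
have Nn : N \is normalmx by apply/normalmxP; rewrite NN NN'.
have [W [lam [WW NE]]] : exists (W : 'M[C]_(m + m)) (lam : 'rV[C]_(m + m)),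
    W *m W^t* = 1%:M /\ N = W^t* *m diag_mx lam *m W.
  exists (spectralmx N), (spectral_diag N); split.
    by apply/unitarymxP/spectral_unitarymx.
  rewrite -invmx_unitary; last exact: spectral_unitarymx.
  exact/orthomx_spectralP.
have WW' : W^t* *m W = 1%:M by apply: mulmx1C.
exists (W *m col_mx 1%:M 0), lam; split.
- rewrite trmxC_mul -mulmxA [W^t* *m _]mulmxA WW' mul1mx.
  by rewrite tr_col_mx map_row_mx mul_row_col trmxC1 mulmx1 mulmx0 addr0.
- have -> : (W *m col_mx 1%:M 0)^t* *m diag_mx lam *m (W *m col_mx 1%:M 0) =
            (col_mx 1%:M 0)^t* *m (W^t* *m diag_mx lam *m W) *m col_mx 1%:M (0 : 'M_m).
    by rewrite trmxC_mul !mulmxA.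
  rewrite -NE.
  rewrite -mulmxA /N mul_block_col !mulmx1 !mulmx0 !addr0 tr_col_mx map_row_mx.
  by rewrite mul_row_col trmxC1 mul1mx trmx0 map_mx0 mul0mx addr0.
- move=> k.
  have h : diag_mx (map_mx Num.conj lam) *m diag_mx lam = 1%:M.
    have := congr1 (fun M => W *m M *m W^t*) NN.
    rewrite mulmx1 WW NE !trmxC_mul trmxCK -!mulmxA WW mulmx1.
    rewrite [W *m (W^t* *m _)]mulmxA WW mul1mx [W *m (W^t* *m _)]mulmxA WW mul1mx.
    by rewrite tr_diag_mx map_diag_mx.
  have := congr1 (fun M : 'M_(m + m) => M k k) h.
  rewrite mul_diag_mx !mxE eqxx !mulr1n mulrC -normCK => /eqP.
  by rewrite sqrp_eq1 // => /eqP.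
Qed.

Lemma diagonal_dilation m (T : 'M[C]_m) r : 0 < r -> mxnorm T <= r ->
  exists (U : 'M[C]_(m + m, m)) (lam : 'rV[C]_(m + m)),
    [/\ U^t* *m U = 1%:M, U^t* *m diag_mx lam *m U = T
      & forall k, `|lam 0 k| = rc r].
Proof.
move=> r0 Tr.
have rc0 : rc r != 0 by rewrite (inj_eq (@complexI R) r 0) gt_eqF.
have [|U [lam [UU UE lam1]]] := @contraction_dilation m ((rc r)^-1 *: T).
  apply: le_trans (mxnormZ _ _) _.
  have -> : cabs (rc r)^-1 = r^-1.
    by rewrite -(fmorphV (real_complex R)) cabs_real ger0_norm // invr_ge0 ltW.
  by rewrite ler_pdivrMl // mulr1.
exists U, (rc r *: lam); split => //.
  have -> : diag_mx (rc r *: lam) = rc r *: diag_mx lam.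
    by apply/matrixP => i j; rewrite !mxE mulrnAr.
  by rewrite -scalemxAr -scalemxAl UE scalerA divff // scale1r.
move=> k; rewrite mxE normrM lam1 mulr1 ger0_norm // ler0c ltW //.
Qed.

End UnitaryDilation.

(** * Norm-continuous operator paths and their moduli of continuity *)

Section OperatorPaths.
Variable R : realType.
Implicit Types H K : preHilbert R.

Lemma opnorm_self H K (T : H -> K) : opnorm (fun x => T x - T x) = 0.
Proof.
apply/eqP; rewrite eq_le; apply/andP; split.
  by apply: opnorm_le => // x; rewrite subrr hnorm0 mul0r.
apply: ub_le_sup; last by exists 0 => /=; rewrite ?subrr hnorm0.
by exists 0 => _ [x _ <-]; rewrite subrr hnorm0.
Qed.

Lemma cont_op_path_bl H K (T : R -> H -> K) t :
  cont_op_path T -> unit_interval t -> bounded_linear (T t).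
Proof. by move=> [h _]; apply: h. Qed.

Lemma cont_op_path_blB H K (T : R -> H -> K) t t' :
  cont_op_path T -> unit_interval t -> unit_interval t' ->
  bounded_linear (fun x => T t x - T t' x).
Proof. by move=> cT ti ti'; apply: bounded_linearB; apply: cont_op_path_bl cT _. Qed.

Lemma op_dist_triangle H K (T : R -> H -> K) t s u :
  cont_op_path T -> unit_interval t -> unit_interval s -> unit_interval u ->
  opnorm (fun x => T t x - T u x) <=
    opnorm (fun x => T t x - T s x) + opnorm (fun x => T s x - T u x).
Proof. by move=> cT *; apply: opnormB_triangle; apply: cont_op_path_bl cT _. Qed.

Lemma op_dist_ge0 H K (T : R -> H -> K) t t' :
  cont_op_path T -> unit_interval t -> unit_interval t' ->
  0 <= opnorm (fun x => T t x - T t' x).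
Proof. by move=> cT ti ti'; apply/opnorm_ge0/cont_op_path_blB. Qed.

(** Compactness of the interval is replaced by a supremum argument: S collects the x for which one d
    works on [0, x], and continuity at sup S lets S reach past its supremum unless that is 1. *)
Lemma op_path_unif_cont H K (T : R -> H -> K) : cont_op_path T ->
  forall e : R, 0 < e -> exists2 d : R, 0 < d &
    forall t t', unit_interval t -> unit_interval t' -> `|t - t'| < d ->
      opnorm (fun x => T t x - T t' x) < e.
Proof.
move=> cT e e0.
pose S := [set x : R | 0 <= x <= 1 /\ exists2 d : R, 0 < d &
  forall t t', 0 <= t <= x -> 0 <= t' <= x -> `|t - t'| < d ->
    opnorm (fun x => T t x - T t' x) < e].
have S0 : S 0.
  split; first by rewrite lexx ler01.
  exists 1 => // t t'; rewrite -!eq_le => /eqP <- /eqP <- _.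
  by rewrite opnorm_self.
have supS : has_sup S by split; [exists 0 | exists 1 => x [/andP[]]].
have s0 : 0 <= sup S by apply: ub_le_sup => //; case: supS.
have s1 : sup S <= 1 by apply: ge_sup; [exists 0 | move=> x [/andP[]]].
have si : unit_interval (sup S) by apply/andP.
have [d d0 hd] := cT.2 _ si (e / 2) ltac:(by rewrite divr_gt0).
have near t : unit_interval t -> `|sup S - t| < d ->
    opnorm (fun x => T t x - T (sup S) x) < e / 2.
  by move=> ti h; rewrite opnormB_sym; apply: hd.
have close t t' : unit_interval t -> unit_interval t' ->
    `|sup S - t| < d -> `|sup S - t'| < d -> opnorm (fun x => T t x - T t' x) < e.
  move=> ti ti' h h'; apply: le_lt_trans (op_dist_triangle cT ti si ti') _.
  rewrite [ltRHS](splitr e); apply: ltrD; first exact: near.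
  by rewrite opnormB_sym; apply: near.
have [x Sx hx] := @sup_adherent _ S (d / 2) ltac:(by rewrite divr_gt0) supS.
have [/andP[x0 x1] [dx dx0 hdx]] := Sx.
have xs : x <= sup S by apply: ub_le_sup => //; case: supS.
(* Once y lies in S it is at most sup S, which is possible only if the minimum is 1. *)
pose y := Num.min 1 (sup S + d / 2).
have Sy : S y.
  split; first by rewrite /y le_min ler01 ge_min lexx /= addr_ge0 // divr_ge0 // ltW.
  (* If one of two points at distance less than d/2 exceeds x, which is itself within d/2 of sup S,
     then both lie within d of sup S, so [close] applies. *)
  exists (Num.min dx (d / 2)); first by rewrite lt_min dx0 divr_gt0.
  move=> t t' /andP[t0]; rewrite le_min => /andP[t1 ts].
  move=> /andP[t'0]; rewrite le_min => /andP[t'1 t's].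
  rewrite lt_min => /andP[h1 h2].
  have [/andP[tx t'x]|] := boolP ((t <= x) && (t' <= x)).
    by apply: hdx => //; apply/andP.
  rewrite negb_and -!ltNge => far; apply: close; [by apply/andP|by apply/andP| |];
    move: h2; rewrite !ltr_norml => /andP[h2 h3]; apply/andP; case/orP: far => far; split; lra.
have ys : y <= sup S by apply: ub_le_sup => //; case: supS.
have y1 : y = 1.
  by apply: min_l; move: ys; rewrite /y ge_min => /orP[h|h]; have := s1; have := d0; lra.
by rewrite y1 in Sy; have [_ [d1 d10 hd1]] := Sy; exists d1 => // t t' ti ti'; apply: hd1.
Qed.

Lemma unit_interval_grid (N : nat) (t : R) : (0 < N)%N -> unit_interval t ->
  exists i : 'I_N.+1, `|t - i%:R / N%:R| <= N%:R^-1.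
Proof.
move=> N0 /andP[t0 t1].
have Np : 0 < N%:R :> R by rewrite ltr0n.
have tN0 : 0 <= t * N%:R by rewrite mulr_ge0.
have hi : (Num.trunc (t * N%:R) < N.+1)%N.
  rewrite ltnS -(ler_nat R) (le_trans (_ : _ <= t * N%:R)) ?truncn_le //.
  by rewrite -[leRHS]mul1r ler_wpM2r.
exists (Ordinal hi) => /=; have /andP[h1 h2] := truncn_itv tN0.
rewrite -(ler_pM2r Np) mulVf ?gt_eqF // -[X in _ * X](gtr0_norm Np) -normrM.
rewrite mulrBl divfK ?gt_eqF // ger0_norm ?subr_ge0 // lerBlDl.
by rewrite -natr1 in h2; exact: ltW.
Qed.

Lemma inv_nat_lt (d : R) : 0 < d -> exists2 N : nat, (0 < N)%N & N%:R^-1 < d.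
Proof.
move=> d0; have v0 : 0 <= d^-1 by rewrite invr_ge0 ltW.
have h := archi_boundP v0; exists (Num.bound d^-1).
  by rewrite -(ltr0n R); apply: le_lt_trans h.
by rewrite invf_plt ?posrE //; apply: le_lt_trans h.
Qed.

Lemma unit_interval_node (N : nat) (i : 'I_N.+1) : (0 < N)%N ->
  unit_interval (i%:R / N%:R : R).
Proof.
move=> N0; have Np : 0 < N%:R :> R by rewrite ltr0n.
apply/andP; split; first by rewrite divr_ge0.
by rewrite ler_pdivrMr // mul1r ler_nat -ltnS.
Qed.

(** The supremum in [op_modulus] is informative only for a set that is bounded above. Points are
    moved to nodes of a fine grid at cost 1 each, and the finitely many distances between nodes are
    bounded by their sum. *)
Lemma op_dist_bounded H K (T : R -> H -> K) : cont_op_path T ->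
  exists B : R, forall t t', unit_interval t -> unit_interval t' ->
    opnorm (fun x => T t x - T t' x) <= B.
Proof.
move=> cT; have [d d0 hd] := op_path_unif_cont cT ltr01.
have [N N0 hN] := inv_nat_lt d0.
have hn (i : 'I_N.+1) := unit_interval_node i N0.
pose c := \sum_(i < N.+1) \sum_(j < N.+1)
   opnorm (fun x => T (i%:R / N%:R) x - T (j%:R / N%:R) x).
exists (1 + c + 1) => t t' ti ti'.
have [i hi] := unit_interval_grid N0 ti; have [j hj] := unit_interval_grid N0 ti'.
apply: le_trans (op_dist_triangle cT ti (hn j) ti') _.
apply: lerD; last first.
  by rewrite opnormB_sym ltW //; apply: hd => //; apply: le_lt_trans hN.
apply: le_trans (op_dist_triangle cT ti (hn i) (hn j)) _.
apply: lerD; first by rewrite ltW //; apply: hd => //; apply: le_lt_trans hN.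
rewrite /c (bigD1 i) //= (bigD1 j) //= -addrA lerDl addr_ge0 //.
  by apply: sumr_ge0 => k _; apply: op_dist_ge0.
by apply: sumr_ge0 => k _; apply: sumr_ge0 => l _; apply: op_dist_ge0.
Qed.

Lemma op_modulus_has_ub H K (T : R -> H -> K) s : cont_op_path T ->
  has_ubound [set opnorm (fun x => T tt.1 x - T tt.2 x) | tt in
        [set tt : R * R | unit_interval tt.1 /\ unit_interval tt.2 /\
                          `|tt.1 - tt.2| <= s]].
Proof.
move=> cT; have [B hB] := op_dist_bounded cT.
by exists B => _ [[t t'] /= [ti [ti' _]] <-]; apply: hB.
Qed.

Lemma op_modulus_ub H K (T : R -> H -> K) t t' s :
  cont_op_path T -> unit_interval t -> unit_interval t' -> `|t - t'| <= s ->
  opnorm (fun x => T t x - T t' x) <= op_modulus T s.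
Proof.
move=> cT ti ti' hs; apply: ub_le_sup; first exact: op_modulus_has_ub.
by exists (t, t').
Qed.

Lemma op_modulus_le H K (T : R -> H -> K) s c : 0 <= s ->
  (forall t t', unit_interval t -> unit_interval t' -> `|t - t'| <= s ->
    opnorm (fun x => T t x - T t' x) <= c) -> op_modulus T s <= c.
Proof.
move=> s0 h; apply: ge_sup; last first.
  by move=> _ [[t t'] /= [ti [ti' ht]] <-]; apply: h.
exists (opnorm (fun x => T 0 x - T 0 x)), (0, 0) => //=.
by rewrite /unit_interval /= lexx ler01 subrr normr0.
Qed.

Lemma op_modulus_modulus H K (T : R -> H -> K) :
  cont_op_path T -> modulus_of_continuity (op_modulus T).
Proof.
move=> cT; have i0 : @unit_interval R 0 by rewrite /unit_interval /= lexx ler01.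
have ge0 s : 0 <= s -> 0 <= op_modulus T s.
  move=> s0; apply: le_trans (op_dist_ge0 cT i0 i0) _.
  by apply: op_modulus_ub => //; rewrite subrr normr0.
split=> //; split; [|split].
- move=> s s' s0 ss'; apply: op_modulus_le => // t t' ti ti' h.
  by apply: op_modulus_ub => //; apply: le_trans ss'.
- apply/eqP; rewrite eq_le ge0 // andbT; apply: op_modulus_le => // t t' ti ti'.
  by rewrite normr_le0 subr_eq0 => /eqP ->; rewrite opnorm_self.
- move=> e e0; have [|d d0 hd] := op_path_unif_cont cT (_ : 0 < e / 2).
    by rewrite divr_gt0.
  exists d => // s s0 sd; apply: (@le_lt_trans _ _ (e / 2)); last first.
    by rewrite ltr_pdivrMr // ltr_pMr // ltr1n.
  apply: op_modulus_le; first exact: ltW.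
  by move=> t t' ti ti' h; rewrite ltW //; apply: hd => //; apply: le_lt_trans sd.
Qed.

End OperatorPaths.

(** * Compressions to finite orthonormal families and the essential numerical range *)

Section FiniteSystems.
Variables (R : realType) (H : preHilbert R).
Local Notation C := R[i].
Local Notation rc r := (real_complex R r).

Definition lc m (w : 'I_m -> H) (x : 'cV[C]_m) : H := \sum_a x a 0 *: w a.

Definition comp_mx m m' (T : H -> H) (w : 'I_m -> H) (w' : 'I_m' -> H) :
  'M[C]_(m', m) := \matrix_(i, j) hdot (T (w j)) (w' i).

Definition ortho_fam m (w : 'I_m -> H) : Prop :=
  forall a b, hdot (w a) (w b) = (a == b)%:R.

Lemma lcDl m (w : 'I_m -> H) a x y : lc w (a *: x + y) = a *: lc w x + lc w y.
Proof.
rewrite /lc scaler_sumr -big_split; apply: eq_bigr => i _ /=.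
by rewrite !mxE scalerDl scalerA.
Qed.

Lemma lc0 m (w : 'I_m -> H) : lc w 0 = 0.
Proof. by rewrite /lc big1 // => i _; rewrite mxE scale0r. Qed.

Lemma lcZ m (w : 'I_m -> H) a x : lc w (a *: x) = a *: lc w x.
Proof. by have := lcDl w a x 0; rewrite lc0 !addr0. Qed.

Lemma lcD m (w : 'I_m -> H) x y : lc w (x + y) = lc w x + lc w y.
Proof. by have := lcDl w 1 x y; rewrite !scale1r. Qed.

Lemma lcB m (w : 'I_m -> H) x y : lc w (x - y) = lc w x - lc w y.
Proof. by rewrite lcD -[- y]scaleN1r lcZ scaleN1r. Qed.

Lemma hdot_lc m m' (T : H -> H) (w : 'I_m -> H) (w' : 'I_m' -> H) x y :
  bounded_linear T ->
  hdot (T (lc w x)) (lc w' y) = cdot (comp_mx T w w' *m x) y.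
Proof.
move=> bT; rewrite hdot_sumr; apply: eq_bigr => i _; rewrite hdotZr mulrC.
congr (_ * _); rewrite (bounded_linear_sum _ _ _ bT) hdot_suml mxE.
by apply: eq_bigr => j _; rewrite (bounded_linearZ _ _ bT) hdotZ mxE mulrC.
Qed.

Lemma bounded_linear_id : bounded_linear (fun x : H => x).
Proof. by split=> //; exists 1 => x; rewrite mul1r. Qed.

Lemma hdot_lc_ortho m (w : 'I_m -> H) x y : ortho_fam w ->
  hdot (lc w x) (lc w y) = cdot x y.
Proof.
move=> ow; rewrite (hdot_lc w w x y bounded_linear_id).
have -> : comp_mx (fun x : H => x) w w = 1%:M; last by rewrite mul1mx.
by apply/matrixP => i j; rewrite !mxE ow eq_sym.
Qed.

Lemma hnorm_lc m (w : 'I_m -> H) x : ortho_fam w -> hnorm (lc w x) = vnorm x.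
Proof.
by move=> ow; apply: hnorm_eqP; rewrite ?vnorm_ge0 // vnorm_sqr hdot_lc_ortho.
Qed.

Lemma mxnorm_comp m m' (T : H -> H) (w : 'I_m -> H) (w' : 'I_m' -> H) :
  bounded_linear T -> ortho_fam w -> ortho_fam w' ->
  mxnorm (comp_mx T w w') <= opnorm T.
Proof.
move=> bT ow ow'; apply: mxnorm_le => [|x]; first exact: opnorm_ge0.
set M := comp_mx _ _ _.
have [->|v0] := eqVneq (vnorm (M *m x)) 0.
  by rewrite mulr_ge0 ?opnorm_ge0 ?vnorm_ge0.
have vp : 0 < vnorm (M *m x) by rewrite lt_neqAle eq_sym v0 vnorm_ge0.
rewrite -(ler_pM2r vp) -expr2.
have -> : vnorm (M *m x) ^+ 2 = cabs (rc (vnorm (M *m x) ^+ 2)).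
  by rewrite cabs_real ger0_norm // exprn_ge0 // ltW.
rewrite vnorm_sqr -hdot_lc //; apply: le_trans (hdot_CS _ _) _.
rewrite (hnorm_lc _ ow') ler_wpM2r ?vnorm_ge0 // -(hnorm_lc x ow).
exact: opnorm_ub.
Qed.

Lemma comp_mxB m m' (S T : H -> H) (w : 'I_m -> H) (w' : 'I_m' -> H) :
  comp_mx (fun x => S x - T x) w w' = comp_mx S w w' - comp_mx T w w'.
Proof. by apply/matrixP => i j; rewrite !mxE hdotB. Qed.

Lemma ortho_sub u m (g : 'I_m -> nat) : Defs.orthonormal u -> injective g ->
  ortho_fam (fun p => u (g p) : H).
Proof. by move=> ou ig a b; rewrite ou (inj_eq ig); case: eqP. Qed.

Definition linear_functional (f : H -> C) : Prop :=
  forall a x y, f (a *: x + y) = a * f x + f y.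

Lemma functional_lc f m (w : 'I_m -> H) x : linear_functional f ->
  f (lc w x) = \sum_a x a 0 * f (w a).
Proof.
move=> lf; have f0 : f 0 = 0.
  have := lf 1 0 0; rewrite scale1r mul1r addr0 => h.
  by apply: (addrI (f 0)); rewrite addr0.
rewrite /lc; elim/big_rec2: _ => // i x1 x2 _ <-.
by rewrite lf.
Qed.

(** Bessel's inequality: a bounded functional has square-summable values on an orthonormal sequence,
    so only finitely many of them exceed e. *)
Lemma functional_to_zero (f : H -> C) (c : R) (u : nat -> H) :
  linear_functional f -> (forall x, cabs (f x) <= c * hnorm x) -> Defs.orthonormal u ->
  forall e : R, 0 < e -> exists N, forall n, (N <= n)%N -> cabs (f (u n)) <= e.
Proof.
move=> lf hf ou e e0; pose S n := \sum_(i < n) cabs (f (u i)) ^+ 2.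
have Sc n : S n <= c ^+ 2.
  (* On the combination with coefficients conj (f u_i) the functional takes the value S n, while the
     norm of that combination is the square root of S n; boundedness then gives S n <= c^2. *)
  pose x : 'cV[C]_n := \col_i (f (u i))^*.
  have ow := ortho_sub ou (@ord_inj n).
  have Sx : S n = vnorm x ^+ 2.
    by rewrite vnormE; apply: eq_bigr => i _; rewrite mxE cabsJ.
  have := hf (lc (fun p : 'I_n => u p) x).
  rewrite (hnorm_lc _ ow) functional_lc //.
  have -> : \sum_a x a 0 * f (u a) = rc (S n).
    rewrite /S rmorph_sum; apply: eq_bigr => i _; rewrite mxE.
    by apply/esym; rewrite mulrC; exact: cabs_sqr.
  rewrite cabs_real ger0_norm; last by rewrite Sx exprn_ge0 ?vnorm_ge0.
  have := vnorm_ge0 x; rewrite Sx.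
  have [->|v0] := eqVneq (vnorm x) 0; first by rewrite expr0n sqr_ge0.
  move=> vx; rewrite expr2 ler_pM2r; last by rewrite lt_neqAle eq_sym v0.
  by move=> h; rewrite -expr2 ler_sqr ?nnegrE //; apply: le_trans h.
apply: contrapT => /forallNP h.
have {}h N : exists2 n, (N <= n)%N & e < cabs (f (u n)).
  have /existsNP[n /not_implyP[Nn /negP hn]] := h N.
  by exists n => //; rewrite ltNge.
have {}h k : exists n, k%:R * e ^+ 2 <= S n.
  elim: k => [|k [n hn]].
    by exists 0; rewrite mul0r /S big_ord0.
  have [p np hp] := h n; exists p.+1.
  rewrite /S big_ord_recr -natr1 mulrDl mul1r /= lerD //; last first.
    by rewrite ler_sqr ?nnegrE ?cabs_ge0 // ltW.
  apply: le_trans hn _; rewrite /S -(subnKC np) big_split_ord /= lerDl.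
  by apply: sumr_ge0 => i _; rewrite exprn_ge0 ?cabs_ge0.
have e2 : 0 < e ^+ 2 by rewrite exprn_gt0.
have [n hn] := h (Num.bound (c ^+ 2 / e ^+ 2)).
have := le_trans hn (Sc n); rewrite leNgt -ltr_pdivrMr //.
by rewrite archi_boundP // divr_ge0 // ?sqr_ge0 // ltW.
Qed.

Lemma ltn_upto_eventually K (P : nat -> nat -> Prop) :
  (forall p, (p < K)%N -> exists N, forall n, (N <= n)%N -> P p n) ->
  exists N, forall n, (N <= n)%N -> forall p, (p < K)%N -> P p n.
Proof.
elim: K => [|K IH] h; first by exists 0.
have [N1 h1] := IH (fun p pK => h p (ltnW pK)); have [N2 h2] := h K (ltnSn K).
exists (maxn N1 N2) => n; rewrite geq_max => /andP[n1 n2] p.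
by rewrite ltnS leq_eqVlt => /orP[/eqP -> | pK]; [apply: h2 | apply: h1].
Qed.

(* Along an orthonormal sequence both <T u_p, .> and <T ., u_p> tend to 0. *)
Lemma sparse_subsequence (T : H -> H) u lam K (e : R) :
  bounded_linear T -> Defs.orthonormal u -> 0 < e ->
  (forall e : R, 0 < e -> exists N : nat, forall n, (N <= n)%N ->
       `|hdot (T (u n)) (u n) - lam| < rc e) ->
  exists g : nat -> nat, forall p q, (p < K)%N -> (q < K)%N ->
    (g p = g q -> p = q) /\
    cabs (hdot (T (u (g p))) (u (g q)) - (p == q)%:R * lam) <= e.
Proof.
move=> bT ou e0 hl; have [N0 h0] := hl e e0; have [c hc] := bT.2.
suff [g hg] : exists g : nat -> nat, (forall p, (p < K)%N -> (N0 <= g p)%N) /\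
  forall p q, (p < q)%N -> (q < K)%N -> (g p < g q)%N /\
    cabs (hdot (T (u (g p))) (u (g q))) <= e /\
    cabs (hdot (T (u (g q))) (u (g p))) <= e.
  exists g => p q pK qK; case: hg => gN hg; case: (ltngtP p q) => [pq|qp|->].
  - have [h1 [h2 h3]] := hg _ _ pq qK; rewrite mul0r subr0; split => // h.
    by rewrite h ltnn in h1.
  - have [h1 [h2 h3]] := hg _ _ qp pK; rewrite mul0r subr0; split => // h.
    by rewrite h ltnn in h1.
  - by split=> //; rewrite mul1r cabs_le ltW //; apply: h0; apply: gN.
elim: K => [|K [g [gN hg]]]; first by exists id.
have [N1 h1] : exists N, forall n, (N <= n)%N -> forall p, (p < K)%N ->
    (g p < n)%N /\ cabs (hdot (T (u (g p))) (u n)) <= e /\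
    cabs (hdot (T (u n)) (u (g p))) <= e.
  apply: ltn_upto_eventually => p pK.
  have [N2 h2] : exists N, forall n, (N <= n)%N -> cabs (hdot (u n) (T (u (g p)))) <= e.
    apply: (@functional_to_zero (fun x => hdot x (T (u (g p)))) (hnorm (T (u (g p))))) => //.
      by move=> a x y; rewrite hdotDl.
    by move=> x; rewrite mulrC; apply: hdot_CS.
  have [N3 h3] : exists N, forall n, (N <= n)%N -> cabs (hdot (T (u n)) (u (g p))) <= e.
    apply: (@functional_to_zero (fun x => hdot (T x) (u (g p))) (c * hnorm (u (g p)))) => //.
      by move=> a x y; rewrite bT.1 hdotDl.
    move=> x; apply: le_trans (hdot_CS _ _) _.
    by rewrite mulrAC ler_wpM2r ?hnorm_ge0.
  exists (maxn (g p).+1 (maxn N2 N3)) => n; rewrite !geq_max => /and3P[n1 n2 n3].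
  by split=> //; split; [rewrite hdotC cabsJ; apply: h2 | apply: h3].
exists (fun p => if (p < K)%N then g p else maxn N0 N1); split.
  by move=> p _; case: ifP => pK; rewrite ?leq_maxl // gN.
move=> p q pq; rewrite ltnS leq_eqVlt => /orP[/eqP qK|qK].
  by subst q; rewrite pq ltnn; apply: h1 => //; apply: leq_maxr.
by rewrite (ltn_trans pq qK) qK; apply: hg.
Qed.

Lemma left_kernel_vector m k (M : 'M[C]_(m, k)) : (k < m)%N ->
  exists2 x : 'cV[C]_m, vnorm x = 1 & forall j, \sum_a x a 0 * M a j = 0.
Proof.
move=> km; have : kermx M != 0.
  by rewrite -mxrank_eq0 mxrank_ker subn_eq0 -ltnNge (leq_ltn_trans (rank_leq_col M)).
move=> /rowV0Pn[v /sub_kermxP vM v0].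
have n0 : 0 < vnorm (v^T).
  rewrite lt_neqAle vnorm_ge0 andbT eq_sym; apply: contra v0 => /eqP h.
  by rewrite -[v]trmxK (@hnorm_eq0 _ (Cn R m) _ h) trmx0.
exists (rc (vnorm v^T)^-1 *: v^T).
  by rewrite /vnorm hnormZ cabs_real ger0_norm ?invr_ge0 ?ltW // mulVf // gt_eqF.
move=> j; have := congr1 (fun M : 'rV_k => M 0 j) vM; rewrite !mxE => h.
transitivity (rc (vnorm v^T)^-1 * \sum_a v 0 a * M a j); last by rewrite h mulr0.
rewrite mulr_sumr; apply: eq_bigr => a _.
by rewrite !mxE mulrA.
Qed.

(** On the span of sufficiently sparse terms of the orthonormal sequence, T compresses almost to lam
    times the identity, so every unit vector of the span has numerical value near lam. This leaves
    the freedom to meet any finite number of linear conditions, and lying in L amounts to k of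
    them. *)
Lemma ess_num_range_vector (T : H -> H) lam (L : set H) (J : finType)
    (f : J -> H -> C) (e : R) :
  bounded_linear T -> ess_num_range T lam -> closed_subspace L ->
  finite_codim L -> (forall j, linear_functional (f j)) -> 0 < e ->
  exists v, [/\ L v, hdot v v = 1, forall j, f j v = 0
             & cabs (hdot (T v) v - lam) <= e].
Proof.
move=> bT [u [ou hu]] [L0 [LD [LZ _]]] [k [b hb]] lf e0.
(* One more vector than there are conditions: k coefficients modulo L and one per functional. The
   tolerance below is e divided by the number m * m of entries, since the norm is bounded by the sum
   of the entries. *)
pose m := (k + #|J|).+1.
have m2 : 0 < (m * m)%:R :> R by rewrite ltr0n.
have [g hg] := sparse_subsequence m bT ou (divr_gt0 e0 m2) hu.
pose w (p : 'I_m) := u (g p).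
have ow : ortho_fam w.
  by apply: ortho_sub => // p q h; apply: ord_inj; apply: (hg p q _ _).1.
have /choice[l hl] : forall p, exists l : H, L l /\
    exists c : 'I_k -> C, w p = l + \sum_(i < k) c i *: b i.
  by move=> p; have [l ? ?] := hb (w p); exists l.
have /choice[c hc] : forall p, exists c : 'I_k -> C,
    w p = l p + \sum_(i < k) c i *: b i by move=> p; have [] := hl p.
pose M : 'M[C]_(m, k + #|J|) :=
  \matrix_p row_mx (\row_i c p i) (\row_j f (enum_val j) (w p)).
have [x x1 hx] := left_kernel_vector M (ltnSn _).
exists (lc w x); split.
- have -> : lc w x = \sum_p x p 0 *: l p.
    rewrite /lc; under eq_bigr do rewrite hc scalerDr.
    rewrite big_split /= -[RHS]addr0; congr (_ + _).
    under eq_bigr do rewrite scaler_sumr.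
    rewrite exchange_big big1 // => i _ /=.
    under eq_bigr do rewrite scalerA.
    rewrite -scaler_suml.
    have := hx (lshift _ i); under eq_bigr do rewrite mxE row_mxEl mxE.
    by move=> ->; rewrite scale0r.
  by elim/big_ind: _ => // p _; apply: LZ; have [] := hl p.
- by rewrite hdot_lc_ortho // -vnorm_sqr x1 expr1n rmorph1.
- move=> j; rewrite functional_lc //; have := hx (rshift _ (enum_rank j)).
  under eq_bigr do rewrite mxE row_mxEr mxE enum_rankK.
  by [].
- have -> : lam = cdot (lam%:M *m x) x.
    rewrite mul_scalar_mx -[cdot _ _]/(hdot (lam *: x : Cn R m) x) hdotZ hdot_xx.
    by rewrite [hnorm _]x1 expr1n rmorph1 mulr1.
  rewrite (hdot_lc w w x x bT) -[cdot _ _ - _](@hdotB _ (Cn R m)) -mulmxBl.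
  apply: le_trans (@hdot_CS _ (Cn R m) _ _) _; rewrite [X in _ * X]x1 mulr1.
  apply: le_trans (mx_entry_ub _ _) _; rewrite x1 mulr1.
  apply: (@le_trans _ _ (\sum_(p < m) \sum_(q < m) e / (m * m)%:R)).
    apply: ler_sum => p _; apply: ler_sum => q _; rewrite !mxE.
    have [_] := hg q p (ltn_ord _) (ltn_ord _).
    by rewrite eq_sym mulr_natl.
  rewrite !big_const_ord !iter_addr_0 -mulrnA -[_ *+ _]mulr_natr divfK //.
  by rewrite gt_eqF.
Qed.

End FiniteSystems.

(** * Selection of almost decoupled vectors and blocks inside L *)

Section VectorSelection.
Variables (R : realType) (H : preHilbert R).
Local Notation C := R[i].
Local Notation rc r := (real_complex R r).

Lemma path_unif_grid (K : preHilbert R) (T : R -> H -> K) (e : R) :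
  cont_op_path T -> 0 < e -> exists2 Q : nat, (0 < Q)%N &
    forall s, unit_interval s -> exists q : 'I_Q.+1,
      opnorm (fun x => T s x - T (q%:R / Q%:R) x) <= e.
Proof.
move=> cT e0; have [d d0 hd] := op_path_unif_cont cT e0.
have [Q Q0 hQ] := inv_nat_lt d0; exists Q => // s si.
have [q hq] := unit_interval_grid Q0 si; exists q; rewrite ltW //.
by apply: hd; rewrite ?(le_lt_trans hq) //; apply: unit_interval_node.
Qed.

Lemma hdot_opnorm (S T : H -> H) (x y : H) :
  bounded_linear S -> bounded_linear T -> hnorm x = 1 -> hnorm y = 1 ->
  cabs (hdot (S x) y - hdot (T x) y) <= opnorm (fun x => S x - T x).
Proof.
move=> bS bT x1 y1; rewrite -hdotB; apply: le_trans (hdot_CS _ _) _.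
rewrite y1 mulr1 -[leRHS]mulr1 -x1.
exact: (opnorm_ub (T := fun x => S x - T x) x (bounded_linearB bS bT)).
Qed.

Lemma hnorm_unit (x : H) : hdot x x = 1 -> hnorm x = 1.
Proof. by move=> h; apply: hnorm_eqP; rewrite // h expr1n. Qed.

Section Family.
Variables (A : R -> H -> H) (L : set H) (eps : R).
Hypotheses (cA : cont_op_path A) (clL : closed_subspace L) (fL : finite_codim L).
Hypothesis (eps0 : 0 < eps).

(* Orthogonality to A(s)u, for s in a fine finite grid, is a finite set of
   linear constraints; the remaining s are reached by uniform continuity. *)
Lemma next_vector (u : nat -> H) M t lam : unit_interval t ->
  ess_num_range (A t) lam -> (forall k, (k < M)%N -> hdot (u k) (u k) = 1) ->
  exists v, [/\ L v, hdot v v = 1, forall k, (k < M)%N -> hdot v (u k) = 0,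
    forall s k, unit_interval s -> (k < M)%N ->
      cabs (hdot (A s v) (u k)) <= eps /\ cabs (hdot (A s (u k)) v) <= eps
    & cabs (hdot (A t v) v - lam) <= eps].
Proof.
move=> ti hlam u1; have [Q Q0 hQ] := path_unif_grid cA eps0.
have node (q : 'I_Q.+1) : bounded_linear (A (q%:R / Q%:R)).
  by apply: cont_op_path_bl => //; apply: unit_interval_node.
pose f (j : 'I_M * 'I_Q.+1 * 'I_3) (x : H) : C := match val j.2 with
  | 0 => hdot x (u j.1.1)
  | 1 => hdot (A (j.1.2%:R / Q%:R) x) (u j.1.1)
  | _ => hdot x (A (j.1.2%:R / Q%:R) (u j.1.1)) end.
have lf j : linear_functional (f j).
  move=> a x y; rewrite /f; case: (val j.2) => [|[|_]]; rewrite -?hdotDl //.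
  by rewrite (node _).1.
have bt : bounded_linear (A t) by apply: cont_op_path_bl.
have [v [Lv v1 fv hv]] := ess_num_range_vector bt hlam clL fL lf eps0.
exists v; split => // [k kM|s k si kM].
  by have := fv (Ordinal kM, ord0, ord0).
have [q hq] := hQ s si.
have bs : bounded_linear (A s) by apply: cont_op_path_bl.
have hv1 := hnorm_unit v1; have hu1 := hnorm_unit (u1 k kM).
split; apply: le_trans hq.
  have h : hdot (A (q%:R / Q%:R) v) (u k) = 0.
    by have := fv (Ordinal kM, q, inord 1); rewrite /f /= inordK.
  by have := hdot_opnorm bs (node q) hv1 hu1; rewrite h subr0.
have h : hdot (A (q%:R / Q%:R) (u k)) v = 0.
  have := fv (Ordinal kM, q, inord 2); rewrite /f /= inordK // => h.
  by rewrite hdotC h conjC0.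
by have := hdot_opnorm bs (node q) hu1 hv1; rewrite h subr0.
Qed.

(** Greedy choice, one pair of [s] at a time. A new vector must be almost decoupled from the old
    ones in both orders, because A(x) need not be normal and a bound on <A(x) u, v> says nothing
    about <A(x) v, u>. *)
Lemma select_sequence (s : seq (R * C)) :
  (forall p, p \in s -> unit_interval p.1 /\ ess_num_range (A p.1) p.2) ->
  exists u : nat -> H, forall k, (k < size s)%N ->
    [/\ L (u k),
        cabs (hdot (A (nth (0, 0) s k).1 (u k)) (u k) - (nth (0, 0) s k).2) <= eps
      & forall l, (l < size s)%N -> hdot (u k) (u l) = (k == l)%:R /\
          (k != l -> forall x, unit_interval x -> cabs (hdot (A x (u k)) (u l)) <= eps)].
Proof.
elim/last_ind: s => [|s [t lam] IH] hs; first by exists (fun=> 0).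
have [u hu] : exists u : nat -> H, forall k, (k < size s)%N ->
    [/\ L (u k),
        cabs (hdot (A (nth (0, 0) s k).1 (u k)) (u k) - (nth (0, 0) s k).2) <= eps
      & forall l, (l < size s)%N -> hdot (u k) (u l) = (k == l)%:R /\
          (k != l -> forall x, unit_interval x -> cabs (hdot (A x (u k)) (u l)) <= eps)].
  by apply: IH => p ps; apply: hs; rewrite mem_rcons in_cons ps orbT.
have [ti hlam] : unit_interval t /\ ess_num_range (A t) lam.
  by apply: (hs (t, lam)); rewrite mem_rcons in_cons eqxx.
have u1 k : (k < size s)%N -> hdot (u k) (u k) = 1.
  by move=> ks; have [_ _ /(_ k ks)[-> _]] := hu k ks; rewrite eqxx.
have [v [Lv v1 vu Avu vlam]] := next_vector ti hlam u1.
exists (fun k => if (k < size s)%N then u k else v) => k.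
rewrite size_rcons nth_rcons ltnS leq_eqVlt => /orP[/eqP ->|ks].
  rewrite ltnn eqxx; split => // l; rewrite ltnS leq_eqVlt => /orP[/eqP ->|ls].
    by rewrite ltnn eqxx.
  rewrite ls vu // gtn_eqF //; split => // _ x xi.
  by have [] := Avu x l xi ls.
rewrite ks; have [Lu ulam uu] := hu k ks; split => // l.
rewrite ltnS leq_eqVlt => /orP[/eqP ->|ls]; last by rewrite ls; apply: uu.
rewrite ltnn hdotC vu // ltn_eqF // conjC0; split => // _ x xi.
by have [] := Avu x k xi ks.
Qed.

Lemma select_family (J : finType) (t : J -> R) (lam : J -> C) :
  (forall j, unit_interval (t j) /\ ess_num_range (A (t j)) (lam j)) ->
  exists u : J -> H, forall j,
    [/\ L (u j), cabs (hdot (A (t j) (u j)) (u j) - lam j) <= eps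
      & forall l, hdot (u j) (u l) = (j == l)%:R /\
          (j != l -> forall x, unit_interval x -> cabs (hdot (A x (u j)) (u l)) <= eps)].
Proof.
move=> h; pose s := [seq (t j, lam j) | j <- enum J].
have [|u hu] := @select_sequence s; first by move=> p /mapP[j _ ->]; apply: h.
have ij j : (index j (enum J) < size s)%N by rewrite size_map index_mem mem_enum.
have nj j : nth (0, 0) s (index j (enum J)) = (t j, lam j).
  by rewrite (nth_map j) ?nth_index ?index_mem ?mem_enum.
have eqj j l : (index j (enum J) == index l (enum J)) = (j == l).
  apply/eqP/eqP => [e|-> //].
  by rewrite -[j](@nth_index _ j _ (enum J)) ?mem_enum // e nth_index ?mem_enum.
exists (fun j => u (index j (enum J))) => j.
have [Lu ulam uu] := hu _ (ij j); rewrite nj in ulam; split => // l.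
by have := uu _ (ij l); rewrite eqj.
Qed.

Lemma comp_mx_lc m m' n n' (T : H -> H) (u : 'I_m -> H) (u' : 'I_m' -> H)
    (U : 'M[C]_(m, n)) (U' : 'M[C]_(m', n')) : bounded_linear T ->
  comp_mx T (fun a => lc u (col a U)) (fun b => lc u' (col b U')) =
  U'^t* *m comp_mx T u u' *m U.
Proof.
move=> bT; apply/matrixP => i j; rewrite mxE hdot_lc // cdotE -mulmxA.
rewrite [LHS]mxE [RHS]mxE; apply: eq_bigr => k _; rewrite !mxE; congr (_ * _).
by apply: eq_bigr => l _; rewrite !mxE.
Qed.

(** All vectors of all dilations are selected at once, so different blocks are almost decoupled from
    the start. Passing to the columns of the isometries U is a compression and does not increase
    norms; the factor counts the entries of a matrix of size m + m. *)
Lemma select_blocks (I : finType) m (t r : I -> R) (T : I -> 'M[C]_m) :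
  (forall i, [/\ unit_interval (t i), 0 < r i, mxnorm (T i) <= r i
     & forall z : C, `|z| <= rc (r i) -> ess_num_range (A (t i)) z]) ->
  exists w : I -> 'I_m -> H,
    [/\ forall i a, L (w i a),
        forall i, ortho_fam (w i),
        forall i j a b, i != j -> hdot (w i a) (w j b) = 0,
        forall i j x, i != j -> unit_interval x ->
          mxnorm (comp_mx (A x) (w i) (w j)) <= eps * ((m + m) * (m + m))%:R
      & forall i, mxnorm (comp_mx (A (t i)) (w i) (w i) - T i) <=
          eps * ((m + m) * (m + m))%:R].
Proof.
move=> h; have hbl i : bounded_linear (A (t i)).
  by apply: cont_op_path_bl => //; have [] := h i.
have /choice[U hU] : forall i, exists Ul : 'M[C]_(m + m, m) * 'rV[C]_(m + m),
    [/\ Ul.1^t* *m Ul.1 = 1%:M, Ul.1^t* *m diag_mx Ul.2 *m Ul.1 = T i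
      & forall k, `|Ul.2 0 k| = rc (r i)].
  move=> i; have [_ r0 Tr _] := h i.
  by have [V [lam hV]] := diagonal_dilation r0 Tr; exists (V, lam).
have [|u hu] := @select_family (I * 'I_(m + m))%type (fun j => t j.1) (fun j => (U j.1).2 0 j.2).
  move=> [i k] /=; have [ti _ _ hz] := h i; split => //; apply: hz.
  by have [_ _ ->] := hU i.
pose w i a := lc (fun k => u (i, k)) (col a (U i).1).
have ou i : ortho_fam (fun k => u (i, k)).
  by move=> a b; have [_ _ /(_ (i, b))[-> _]] := hu (i, a); rewrite xpair_eqE eqxx.
have sq (M : 'M[C]_(m + m)) : (forall a b, cabs (M a b) <= eps) ->
    mxnorm M <= eps * ((m + m) * (m + m))%:R.
  move=> hM; apply: le_trans (mxnorm_entries _) _.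
  apply: (@le_trans _ _ (\sum_(p < m + m) \sum_(q < m + m) eps)).
    by apply: ler_sum => p _; apply: ler_sum => q _; apply: hM.
  by rewrite !big_const_ord !iter_addr_0 -mulrnA -[_ *+ _]mulr_natr.
have sqU i j (M : 'M[C]_(m + m)) : (forall a b, cabs (M a b) <= eps) ->
    mxnorm ((U j).1^t* *m M *m (U i).1) <= eps * ((m + m) * (m + m))%:R.
  move=> hM; have Un k : mxnorm (U k).1 <= 1 by apply: mxnorm_isom; have [] := hU k.
  rewrite -[leRHS]mulr1 -[X in X * 1]mul1r; apply: mxnormM_le => //.
  apply: mxnormM_le; last exact: sq.
  by apply: le_trans (mxnorm_adj _) _.
exists w; split.
- move=> i a; case: clL => L0 [LD [LZ _]]; rewrite /w /lc.
  by elim/big_ind: _ => // k _; apply: LZ; have [] := hu (i, k).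
- move=> i a b; rewrite /w hdot_lc_ortho // cdotE; have [UU _ _] := hU i.
  have := congr1 (fun M : 'M_m => M b a) UU; rewrite [RHS]mxE eq_sym => <-.
  by rewrite !mxE; apply: eq_bigr => k _; rewrite !mxE.
- move=> i j a b ij; rewrite /w hdot_suml big1 // => k _.
  rewrite hdotZ hdot_sumr big1 ?mulr0 // => l _; rewrite hdotZr.
  by have [_ _ /(_ (j, l))[-> _]] := hu (i, k); rewrite xpair_eqE (negbTE ij) mulr0.
- move=> i j x ij xi; have bx : bounded_linear (A x) by apply: cont_op_path_bl.
  rewrite comp_mx_lc //; apply: sqU => a b; rewrite mxE.
  have [_ _ /(_ (j, a))[_ hh]] := hu (i, b); apply: hh => //.
  by rewrite xpair_eqE (negbTE ij).
- move=> i; rewrite comp_mx_lc //; have [_ UT _] := hU i.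
  rewrite -UT -mulmxBl -mulmxBr; apply: sqU => a b; rewrite !mxE.
  have [_ h1 h2] := hu (i, b); have [ba|ba] := eqVneq a b.
    by rewrite ba mulr1n in h1 *.
  rewrite mulr0n subr0; have [_ hh] := h2 (i, a); apply: hh; last by have [] := h i.
  by rewrite xpair_eqE eqxx eq_sym.
Qed.

End Family.
End VectorSelection.

(** * Banach's fixed point theorem on a ball of matrices *)

Section FixedPoint.
Variable R : realType.
Local Notation C := R[i].
Local Notation rc r := (real_complex R r).

Lemma half_pow_small (c e : R) : 0 < e -> exists k, c / 2 ^+ k < e.
Proof.
move=> e0; exists (Num.bound (c / e)).
have hb : c / e < 2 ^+ Num.bound (c / e) by apply: upper_nthrootP.
by rewrite ltr_pdivrMr ?exprn_gt0 // mulrC -ltr_pdivrMr.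
Qed.

(** Nested intervals: x_k - 2c/2^k increases, x_k + 2c/2^k decreases, and the supremum of the left
    ends lies in all of them. *)
Lemma real_geometric_limit (x : nat -> R) (c : R) :
  (forall k, `|x k.+1 - x k| <= c / 2 ^+ k) ->
  exists l, forall k, `|x k - l| <= 2 * c / 2 ^+ k.
Proof.
move=> hx; pose a k := x k - 2 * c / 2 ^+ k; pose b k := x k + 2 * c / 2 ^+ k.
have half k : 2 * c / 2 ^+ k.+1 = c / 2 ^+ k.
  by rewrite exprS invfM mulrA [2 * c]mulrC mulfK ?pnatr_eq0.
have dbl k : 2 * c / 2 ^+ k = c / 2 ^+ k + c / 2 ^+ k by rewrite -mulrA mulr2n mulrDl mul1r.
have c0 k : 0 <= c / 2 ^+ k by apply: le_trans (hx k).
have aS k : a k <= a k.+1.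
  rewrite /a half dbl; have := hx k; rewrite ler_norml => /andP[? ?]; lra.
have bS k : b k.+1 <= b k.
  by rewrite /b half dbl; have := hx k; rewrite ler_norml => /andP[? ?]; lra.
have ab k : a k <= b k by rewrite /a /b dbl; have := c0 k; lra.
have amono j k : (j <= k)%N -> a j <= a k.
  by move=> /subnKC <-; elim: (k - j)%N => [|i IH]; rewrite ?addn0 // addnS (le_trans IH).
have bmono j k : (j <= k)%N -> b k <= b j.
  by move=> /subnKC <-; elim: (k - j)%N => [|i IH]; rewrite ?addn0 // addnS (le_trans (bS _)).
have ajbk j k : a j <= b k.
  case: (leqP j k) => [jk|/ltnW kj]; first exact: le_trans (amono _ _ jk) (ab k).
  exact: le_trans (ab j) (bmono _ _ kj).
exists (sup (range a)) => k; rewrite ler_norml; apply/andP; split.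
  have : sup (range a) <= b k.
    by apply: ge_sup; [exists (a 0), 0 | move=> _ [j _ <-]].
  by rewrite /b; lra.
have : a k <= sup (range a).
  by apply: ub_le_sup; [exists (b 0) => _ [j _ <-] | exists k].
by rewrite /a; lra.
Qed.

Lemma cabs_le_ReIm (z : C) : cabs z <= `|complex.Re z| + `|complex.Im z|.
Proof.
have -> : z = rc (complex.Re z) + 'i%C * rc (complex.Im z) by exact: complexE.
apply: le_trans (cabsD _ _) _; rewrite cabsM !cabs_real.
have -> : cabs ('i%C : C) = 1.
  by rewrite /cabs normc_def /= expr0n add0r expr1n sqrtr1.
by case: z => a b /=; rewrite mul1r !mul0r !mul1r subr0 !addr0 ?add0r.
Qed.

Lemma Im_le_cabs (z : C) : `|complex.Im z| <= cabs z.
Proof.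
case: z => a b /=; rewrite /cabs normc_def /= -sqrtr_sqr ler_wsqrtr //.
by rewrite lerDr sqr_ge0.
Qed.

Lemma norm_Re_le_cabs (z : C) : `|complex.Re z| <= cabs z.
Proof. by rewrite -lecR -cabsE; apply: normc_ge_Re. Qed.

Lemma complex_geometric_limit (x : nat -> C) (c : R) :
  (forall k, cabs (x k.+1 - x k) <= c / 2 ^+ k) ->
  exists l, forall k, cabs (x k - l) <= 4 * c / 2 ^+ k.
Proof.
move=> hx.
have [|lr hr] := @real_geometric_limit (fun k => complex.Re (x k)) c.
  by move=> k; rewrite -raddfB; apply: le_trans (norm_Re_le_cabs _) (hx k).
have [|li hi] := @real_geometric_limit (fun k => complex.Im (x k)) c.
  by move=> k; rewrite -raddfB; apply: le_trans (Im_le_cabs _) (hx k).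
exists (Complex lr li) => k; apply: le_trans (cabs_le_ReIm _) _.
rewrite !raddfB /=; have := hr k; have := hi k.
have -> : 4 * c / 2 ^+ k = 2 * c / 2 ^+ k + 2 * c / 2 ^+ k by rewrite -mulrDl -mulrDl; congr (_ * _ / _); lra.
lra.
Qed.

Lemma le_half_pow (x y c : R) : (forall k, x <= y + c / 2 ^+ k) -> x <= y.
Proof.
move=> h; rewrite leNgt; apply/negP => yx.
have xy : 0 < x - y by rewrite subr_gt0.
have [k hk] := half_pow_small c xy.
by have := h k; lra.
Qed.

(** Picard iteration from 0, whose first step has norm at most rho. Completeness is used entry by
    entry, and norm convergence is then recovered by summing the entries. *)
Lemma mx_contraction_fixpoint m n (F : 'M[C]_(m, n) -> 'M[C]_(m, n)) (rho : R) :
  0 <= rho ->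
  (forall Z, mxnorm Z <= rho -> mxnorm (F Z) <= rho) ->
  (forall Z Z', mxnorm Z <= rho -> mxnorm Z' <= rho ->
     mxnorm (F Z - F Z') <= 2^-1 * mxnorm (Z - Z')) ->
  exists2 Z, mxnorm Z <= rho & F Z = Z.
Proof.
move=> r0 Fball Flip.
have [x [x0 xS]] : exists x, x 0 = 0 /\ forall k, x k.+1 = F (x k).
  by exists (fun k => iter k F 0).
have xb k : mxnorm (x k) <= rho.
  by elim: k => [|k IH]; [rewrite x0 mxnorm0 | rewrite xS; apply: Fball].
have xd k : mxnorm (x k.+1 - x k) <= rho / 2 ^+ k.
  elim: k => [|k IH]; first by rewrite expr0 divr1 x0 subr0; apply: xb.
  rewrite [x k.+2]xS [in X in _ - X]xS.
  apply: le_trans (Flip _ _ (xb _) (xb _)) _.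
  by rewrite exprS invfM mulrCA ler_wpM2l // invr_ge0.
have lim i j : exists l, forall k, cabs (x k i j - l) <= 4 * rho / 2 ^+ k.
  apply: complex_geometric_limit => k; apply: le_trans (xd k).
  by have := entry_le_mxnorm (x k.+1 - x k) i j; rewrite !mxE.
have /choice[l hl] : forall ij, exists l, forall k, cabs (x k ij.1 ij.2 - l) <= 4 * rho / 2 ^+ k.
  by move=> ij; apply: lim.
pose Z : 'M[C]_(m, n) := \matrix_(i, j) l (i, j).
(* This constant depends on the size of the matrices, but it only serves to identify the limit; the
   bound rho on the fixed point stays dimension free. *)
pose c := (4 * rho) * (m * n)%:R.
have xZ k : mxnorm (x k - Z) <= c / 2 ^+ k.
  apply: le_trans (mxnorm_entries _) _.
  apply: (@le_trans _ _ (\sum_(i < m) \sum_(j < n) 4 * rho / 2 ^+ k)).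
    apply: ler_sum => i _; apply: ler_sum => j _; rewrite !mxE.
    exact: (hl (i, j)).
  by rewrite !big_const_ord !iter_addr_0 -mulrnA mulnC -[_ *+ _]mulr_natr /c mulrAC.
have Zb : mxnorm Z <= rho.
  apply: (@le_half_pow _ _ c) => k; rewrite -[Z](subKr (x k)).
  by apply: le_trans (mxnormB _ _) _; apply: lerD.
exists Z => //.
have h : mxnorm (F Z - Z) <= 0.
  apply: (@le_half_pow _ _ (c + c)) => k; rewrite add0r mulrDl.
  rewrite -[F Z](subrK (x k.+1)) -addrA; apply: le_trans (mxnormD _ _) _.
  apply: lerD; last first.
    apply: le_trans (xZ _) _; rewrite exprS invfM ler_wpM2l //.
      by rewrite mulr_ge0 ?mulr_ge0.
    by rewrite ler_piMl ?invr_ge0 ?exprn_ge0 // invf_le1 // ler1n.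
  rewrite xS; apply: le_trans (Flip _ _ Zb (xb k)) _.
  apply: le_trans (_ : _ <= mxnorm (Z - x k)) _.
    by rewrite ler_piMl ?mxnorm_ge0 // invf_le1 // ler1n.
  by rewrite -opprB; apply: le_trans (mxnormN _) _.
apply/eqP; rewrite -subr_eq0; apply/eqP/matrixP => i j; rewrite [RHS]mxE.
apply: cabs_eq0; apply/eqP; rewrite eq_le cabs_ge0 andbT.
exact: le_trans (entry_le_mxnorm _ _ _) h.
Qed.

End FixedPoint.

(** * The model compression and the contraction for the parameter Z *)

Section Perturbation.
Variable R : realType.
Local Notation C := R[i].
Local Notation rc r := (real_complex R r).

Lemma conj_rc (r : R) : (rc r)^* = rc r.
Proof. by apply: conj_Creal; rewrite complex_real. Qed.

Lemma subrBB_BB (V : zmodType) (g x y x' y' : V) :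
  g - x - y - (g - x' - y') = - (x - x') - (y - y').
Proof.
by rewrite !opprD !opprK [LHS]addrACA [g - x + _]addrACA subrr add0r.
Qed.

Lemma trmxC_rc m (r : R) : ((rc r)%:M : 'M[C]_m)^t* = (rc r)%:M.
Proof.
apply/matrixP => i j; rewrite !mxE eq_sym; case: (i == j); last by rewrite conjC0.
by rewrite mulr1n conj_rc.
Qed.

Lemma mxnormZr m n (r : R) (M : 'M[C]_(m, n)) :
  mxnorm (rc r *: M) <= `|r| * mxnorm M.
Proof. by rewrite -cabs_real; apply: mxnormZ. Qed.

Lemma mxnorm_compress_le m n (E : 'M[C]_m) (M M' : 'M[C]_(m, n)) :
  mxnorm M <= 2 -> mxnorm M' <= 2 -> mxnorm (M'^t* *m E *m M) <= 4 * mxnorm E.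
Proof.
move=> hM hM'; have -> : 4 * mxnorm E = 2 * mxnorm E * 2 by lra.
apply: mxnormM_le => //; apply: mxnormM_le => //.
exact: le_trans (mxnorm_adj _) hM'.
Qed.

Lemma mxnorm_compress_lip m n (E : 'M[C]_m) (M M' N N' : 'M[C]_(m, n)) d :
  mxnorm M' <= 2 -> mxnorm N <= 2 -> mxnorm (M - N) <= d -> mxnorm (M' - N') <= d ->
  mxnorm (M'^t* *m E *m M - N'^t* *m E *m N) <= 4 * mxnorm E * d.
Proof.
move=> hM' hN hd hd'.
have -> : M'^t* *m E *m M - N'^t* *m E *m N =
    M'^t* *m E *m (M - N) + (M' - N')^t* *m E *m N.
  by rewrite mulmxBr trmxCD trmxCN mulmxDl mulNmx mulmxDl mulNmx addrA subrK.
have -> : 4 * mxnorm E * d = 2 * mxnorm E * d + d * mxnorm E * 2 by lra.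
apply: le_trans (mxnormD _ _) _; apply: lerD.
  apply: mxnormM_le => //; apply: mxnormM_le => //.
  exact: le_trans (mxnorm_adj _) hM'.
apply: mxnormM_le => //; apply: mxnormM_le => //.
exact: le_trans (mxnorm_adj _) hd'.
Qed.

Variable n : nat.
Local Notation par := 'M[C]_(n + n, n).

(* An isometry of weight 1 - tau on the copy carrying D / (1 - tau) and of
   weight tau on the two copies carrying the nilpotent block. *)
Definition stack (tau : R) (Z : par) : 'M[C]_(n + (n + n), n) :=
  col_mx (rc (Num.sqrt (1 - tau)))%:M
         (rc (Num.sqrt tau) *: (col_mx 1%:M 0 + Z)).

Definition model (tau r : R) (D : 'M[C]_n) : 'M[C]_(n + (n + n)) :=
  block_mx (rc ((1 - tau)^-1) *: D) 0 0 (block_mx 0 (rc r)%:M 0 0).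

Lemma sqrt_rcM (r : R) : 0 <= r -> rc (Num.sqrt r) * rc (Num.sqrt r) = rc r.
Proof. by move=> r0; rewrite -rmorphM -expr2 sqr_sqrtr. Qed.

Lemma sqrt_gram m p q (r : R) (A : 'M[C]_(m, p)) (B : 'M[C]_(m, q)) : 0 <= r ->
  (rc (Num.sqrt r) *: A)^t* *m (rc (Num.sqrt r) *: B) = rc r *: (A^t* *m B).
Proof.
move=> r0; rewrite -(sqrt_rcM r0); move: (Num.sqrt r) => a.
by rewrite trmxCZ conj_rc -scalerA scalemxAr scalemxAl.
Qed.

Lemma row_e1 (Z : par) : (col_mx 1%:M (0 : 'M_n))^t* *m Z = usubmx Z.
Proof.
rewrite -{1}(vsubmxK Z) tr_col_mx map_row_mx mul_row_col trmxC1 mul1mx.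
by rewrite trmx0 map_mx0 mul0mx addr0.
Qed.

Lemma col_e1 (Z : par) : Z^t* *m col_mx 1%:M (0 : 'M_n) = (usubmx Z)^t*.
Proof. by rewrite -row_e1 trmxC_mul trmxCK. Qed.

(** The weights 1 - tau and tau add up to 1, so the only obstruction to being an isometry is S + S^*
    + Z^* Z, with S the upper block of Z. *)
Lemma stack_gram tau (Z : par) : 0 <= tau <= 1 ->
  (stack tau Z)^t* *m stack tau Z =
    1%:M + rc tau *: (usubmx Z + (usubmx Z)^t* + Z^t* *m Z).
Proof.
move=> /andP[t0 t1]; rewrite /stack tr_col_mx map_row_mx mul_row_col.
rewrite trmxC_rc -scalar_mxM sqrt_rcM ?subr_ge0 //.
rewrite sqrt_gram //.
have -> : (col_mx 1%:M 0 + Z)^t* *m (col_mx 1%:M 0 + Z) =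
    1%:M + (usubmx Z + (usubmx Z)^t* + Z^t* *m Z).
  rewrite trmxCD mulmxDl !mulmxDr (row_e1 Z) (col_e1 Z) row_e1.
  by rewrite col_mxKu !addrA.
rewrite scalerDr addrA; congr (_ + _).
by rewrite scale_scalar_mx -raddfD mulr1 -rmorphD subrK rmorph1.
Qed.

(** The weight 1 - tau cancels the factor in front of D, and the nilpotent block pairs the second
    component with the third, so that the lower block of Z appears already at first order. *)
Lemma stack_model tau r D (Z : par) : 0 <= tau < 1 ->
  (stack tau Z)^t* *m model tau r D *m stack tau Z =
    D + rc (tau * r) *: ((1%:M + usubmx Z)^t* *m dsubmx Z).
Proof.
move=> /andP[t0 t1]; have s0 : 0 < 1 - tau by rewrite subr_gt0.
rewrite /stack /model tr_col_mx map_row_mx mul_row_block mul_row_col.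
rewrite !mulmx0 addr0 add0r; congr (_ + _).
  rewrite trmxC_rc -scalemxAr mul_scalar_mx.
  rewrite mul_mx_scalar !scalerA mulrAC sqrt_rcM ?ltW // -rmorphM.
  by rewrite divff ?gt_eqF // rmorph1 scale1r.
have -> : col_mx 1%:M 0 + Z = col_mx (1%:M + usubmx Z) (dsubmx Z).
  by rewrite -[in LHS](vsubmxK Z) add_col_mx add0r.
rewrite -mulmxA -scalemxAr sqrt_gram // mul_block_col !mul0mx addr0 add0r.
rewrite tr_col_mx map_row_mx mul_row_col mulmx0 addr0 mul_scalar_mx -scalemxAr.
by rewrite scalerA -rmorphM.
Qed.

Lemma stackB tau (Z Z' : par) : 0 <= tau <= 1 ->
  mxnorm (stack tau Z - stack tau Z') <= mxnorm (Z - Z').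
Proof.
move=> /andP[t0 t1]; rewrite /stack opp_col_mx add_col_mx subrr -scalerBr.
rewrite opprD addrACA subrr add0r; apply: le_trans (mxnorm_col _ _) _.
rewrite mxnorm0 add0r; apply: le_trans (mxnormZr _ _) _.
by rewrite ger0_norm ?sqrtr_ge0 // ler_piMl ?mxnorm_ge0 // -sqrtr1 ler_wsqrtr.
Qed.

Lemma stack_le tau (Z : par) : 0 <= tau <= 1 -> mxnorm (stack tau Z) <= 1 + mxnorm Z.
Proof.
move=> ht; rewrite -[stack tau Z](subrK (stack tau 0)) addrC.
apply: le_trans (mxnormD _ _) _; apply: lerD.
  apply: mxnorm_isom; rewrite stack_gram //.
  have -> : usubmx (0 : par) = 0 by apply/matrixP => i j; rewrite !mxE.
  by rewrite trmx0 map_mx0 mulmx0 !addr0 scaler0 addr0.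
by apply: le_trans (stackB _ _ ht) _; rewrite subr0.
Qed.

Lemma model_le tau r D : 0 <= tau < 1 -> 0 <= r -> mxnorm D <= (1 - tau) * r ->
  mxnorm (model tau r D) <= r.
Proof.
move=> /andP[t0 t1] r0 hD; have s0 : 0 < 1 - tau by rewrite subr_gt0.
apply: mxnorm_le => // x.
rewrite -[in leLHS](vsubmxK x) -[in leRHS](vsubmxK x) /model mul_block_col.
rewrite !mul0mx addr0 add0r -(vsubmxK (dsubmx x)) mul_block_col !mul0mx addr0 add0r.
rewrite -(@ler_pXn2r _ 2) ?nnegrE ?mulr_ge0 ?vnorm_ge0 //.
rewrite exprMn !vnorm_col mulrDr; apply: lerD.
  rewrite -exprMn ler_pXn2r ?nnegrE ?mulr_ge0 ?vnorm_ge0 //.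
  apply: le_trans (mulmx_ub _ _) _; rewrite ler_wpM2r ?vnorm_ge0 //.
  apply: le_trans (mxnormZr _ _) _.
  by rewrite ger0_norm ?ler_pdivrMl // invr_ge0 ltW.
rewrite mul_scalar_mx [vnorm (_ *: _)]hnormZ cabs_real ger0_norm // exprMn.
have -> : vnorm (0 : 'cV[C]_n) = 0 by exact: hnorm0.
by rewrite expr0n addr0 ler_wpM2l ?sqr_ge0 // lerDr sqr_ge0.
Qed.

Section Residual.
Variable I : finType.
Implicit Types (psi tau : I -> R) (E : I -> I -> 'M[C]_(n + (n + n))) (Z : par).

(** The contribution of the errors E to the compressed operator. [E i j] maps block i to block j,
    whence [stack (tau j) Z] stands on the left and [stack (tau i) Z] on the right. *)
Definition residual psi tau E Z : 'M[C]_n :=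
  \sum_i \sum_j rc (psi i * psi j) *: ((stack (tau j) Z)^t* *m E i j *m stack (tau i) Z).

(* The unknown is Z = col_mx S K.  In the equation step Z = Z the upper block is
   the isometry equation, the lower one the exact compression equation. *)
Definition step psi tau E (k : R) (G : 'M[C]_n) Z : par :=
  col_mx (rc (- 2^-1) *: (Z^t* *m Z))
         (G - (usubmx Z)^t* *m dsubmx Z - rc k *: residual psi tau E Z).

Lemma mxnorm_sum2 m (F : I -> I -> 'M[C]_m) (b : I -> I -> R) :
  (forall i j, mxnorm (F i j) <= b i j) ->
  mxnorm (\sum_i \sum_j F i j) <= \sum_i \sum_j b i j.
Proof.
move=> h; apply: le_trans (mxnorm_sum _ _ _) _; apply: ler_sum => i _.
by apply: le_trans (mxnorm_sum _ _ _) _; apply: ler_sum => j _.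
Qed.

Variables (psi tau : I -> R) (E : I -> I -> 'M[C]_(n + (n + n))) (eta k : R) (G : 'M[C]_n).
Hypothesis tau01 : forall i, 0 <= tau i <= 1.
Hypothesis psi0 : forall i, 0 <= psi i.
Hypothesis E_le : \sum_i \sum_j psi i * psi j * mxnorm (E i j) <= eta.

(** The bound 1 + 1/8 is rounded up to 2; the factors 4 in the estimates of [residual] are products
    of two such bounds. *)
Lemma stack_le2 i Z : mxnorm Z <= 8^-1 -> mxnorm (stack (tau i) Z) <= 2.
Proof. by move=> h; apply: le_trans (stack_le _ (tau01 i)) _; lra. Qed.

Lemma residual_le Z : mxnorm Z <= 8^-1 -> mxnorm (residual psi tau E Z) <= 4 * eta.
Proof.
move=> hZ; apply: le_trans (mxnorm_sum2 (b := fun i j => 4 * (psi i * psi j * mxnorm (E i j))) _) _.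
  move=> i j; apply: le_trans (mxnormZr _ _) _.
  rewrite ger0_norm ?mulr_ge0 // mulrCA ler_wpM2l ?mulr_ge0 //.
  by apply: mxnorm_compress_le; apply: stack_le2.
by under eq_bigr do rewrite -mulr_sumr; rewrite -mulr_sumr ler_wpM2l.
Qed.

Lemma residual_lip Z Z' : mxnorm Z <= 8^-1 -> mxnorm Z' <= 8^-1 ->
  mxnorm (residual psi tau E Z - residual psi tau E Z') <= 4 * eta * mxnorm (Z - Z').
Proof.
move=> hZ hZ'; rewrite /residual -sumrB; under eq_bigr do rewrite -sumrB.
apply: le_trans (mxnorm_sum2 (b := fun i j => 4 * mxnorm (Z - Z') * (psi i * psi j * mxnorm (E i j))) _) _.
  move=> i j; rewrite -scalerBr; apply: le_trans (mxnormZr _ _) _.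
  rewrite ger0_norm ?mulr_ge0 // mulrCA ler_wpM2l ?mulr_ge0 // mulrAC.
  by apply: mxnorm_compress_lip; rewrite ?stack_le2 ?stackB.
under eq_bigr do rewrite -mulr_sumr; rewrite -mulr_sumr mulrAC.
by rewrite ler_wpM2r ?mxnorm_ge0 // ler_wpM2l.
Qed.

Hypotheses (k0 : 0 <= k) (k_eta : k * (4 * eta) <= 64^-1) (G_le : mxnorm G <= 64^-1).

(** The upper block costs 1/128; in the lower one G, the quadratic term and the residual cost 1/64
    each. The total 7/128 stays below 1/8. *)
Lemma step_ball Z : mxnorm Z <= 8^-1 -> mxnorm (step psi tau E k G Z) <= 8^-1.
Proof.
move=> hZ; apply: le_trans (mxnorm_col _ _) _.
have h1 : mxnorm (rc (- 2^-1) *: (Z^t* *m Z)) <= 128^-1.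
  apply: le_trans (mxnormZr _ _) _; rewrite normrN ger0_norm ?invr_ge0 //.
  have : mxnorm (Z^t* *m Z) <= 8^-1 * 8^-1.
    by apply: mxnormM_le => //; apply: le_trans (mxnorm_adj _) _.
  lra.
have h2 : mxnorm ((usubmx Z)^t* *m dsubmx Z) <= 8^-1 * 8^-1.
  apply: mxnormM_le; last exact: le_trans (mxnorm_dsub _) _.
  exact: le_trans (mxnorm_adj _) (le_trans (mxnorm_usub _) _).
have h3 : mxnorm (rc k *: residual psi tau E Z) <= 64^-1.
  apply: le_trans (mxnormZr _ _) _; rewrite ger0_norm //.
  by apply: le_trans k_eta; rewrite ler_wpM2l // residual_le.
apply: (@le_trans _ _ (128^-1 + (64^-1 + 8^-1 * 8^-1 + 64^-1))); last by lra.
apply: (lerD h1); apply: le_trans (mxnormB _ _) _; apply: lerD h3.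
by apply: le_trans (mxnormB _ _) _; apply: lerD.
Qed.

(** A product of two factors from the ball of radius 1/8 has Lipschitz constant 1/4. The upper block
    carries half of that, the lower one all of it plus 1/64 from the residual: 25/64 in all, below
    1/2. *)
Lemma step_lip Z Z' : mxnorm Z <= 8^-1 -> mxnorm Z' <= 8^-1 ->
  mxnorm (step psi tau E k G Z - step psi tau E k G Z') <= 2^-1 * mxnorm (Z - Z').
Proof.
move=> hZ hZ'; have bil m1 (S S' K K' : 'M[C]_(m1, n)) : mxnorm S <= 8^-1 -> mxnorm K' <= 8^-1 ->
    mxnorm (S - S') <= mxnorm (Z - Z') -> mxnorm (K - K') <= mxnorm (Z - Z') ->
    mxnorm (S^t* *m K - S'^t* *m K') <= 4^-1 * mxnorm (Z - Z').
  move=> hS hK' hSS hKK.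
  have -> : S^t* *m K - S'^t* *m K' = S^t* *m (K - K') + (S - S')^t* *m K'.
    by rewrite mulmxBr trmxCD trmxCN mulmxDl mulNmx addrA subrK.
  have -> : 4^-1 * mxnorm (Z - Z') = 8^-1 * mxnorm (Z - Z') + mxnorm (Z - Z') * 8^-1 by lra.
  apply: le_trans (mxnormD _ _) _; apply: lerD; apply: mxnormM_le => //.
    exact: le_trans (mxnorm_adj _) _.
  exact: le_trans (mxnorm_adj _) _.
rewrite /step opp_col_mx add_col_mx; apply: le_trans (mxnorm_col _ _) _.
have h1 : mxnorm (rc (- 2^-1) *: (Z^t* *m Z) - rc (- 2^-1) *: (Z'^t* *m Z')) <=
    8^-1 * mxnorm (Z - Z').
  rewrite -scalerBr; apply: le_trans (mxnormZr _ _) _.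
  rewrite normrN ger0_norm ?invr_ge0 //.
  have := bil _ Z Z' Z Z' hZ hZ' (lexx _) (lexx _); lra.
have usubB (Y Y' : par) : usubmx Y - usubmx Y' = usubmx (Y - Y').
  by apply/matrixP => i j; rewrite !mxE.
have dsubB (Y Y' : par) : dsubmx Y - dsubmx Y' = dsubmx (Y - Y').
  by apply/matrixP => i j; rewrite !mxE.
have h2 : mxnorm ((usubmx Z)^t* *m dsubmx Z - (usubmx Z')^t* *m dsubmx Z') <=
    4^-1 * mxnorm (Z - Z').
  apply: bil; rewrite ?usubB ?dsubB ?mxnorm_usub ?mxnorm_dsub //.
    exact: le_trans (mxnorm_usub _) _.
  exact: le_trans (mxnorm_dsub _) _.
have h3 : mxnorm (rc k *: residual psi tau E Z - rc k *: residual psi tau E Z') <=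
    64^-1 * mxnorm (Z - Z').
  rewrite -scalerBr; apply: le_trans (mxnormZr _ _) _; rewrite ger0_norm //.
  apply: (@le_trans _ _ (k * (4 * eta) * mxnorm (Z - Z'))).
    by rewrite -mulrA ler_wpM2l // residual_lip.
  by rewrite ler_wpM2r ?mxnorm_ge0.
rewrite subrBB_BB.
have d0 := mxnorm_ge0 (Z - Z').
apply: (@le_trans _ _ (8^-1 * mxnorm (Z - Z') +
  (4^-1 * mxnorm (Z - Z') + 64^-1 * mxnorm (Z - Z')))); last by lra.
apply: (lerD h1); apply: le_trans (mxnormB _ _) _; apply: lerD h3.
exact: le_trans (mxnormN _) h2.
Qed.

End Residual.
End Perturbation.

Lemma sub_cancel (V : zmodType) (a b c s x : V) :
  a - b - s - (c - b - (x + s)) = x + (a - c).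
Proof.
rewrite !opprB [x + s]addrC -[s + x + _]addrA [LHS]addrA subrK [LHS]addrCA.
by rewrite [a - b + _]addrA subrK.
Qed.

(** * Fixed points solve the isometry and compression equations exactly *)

Section StepSolution.
Variables (R : realType) (n : nat) (I : finType).
Local Notation C := R[i].
Local Notation rc r := (real_complex R r).
Local Notation par := 'M[C]_(n + n, n).
Variables (psi tau r : I -> R) (B : I -> I -> 'M[C]_(n + (n + n))).
Variables (D0 : I -> 'M[C]_n) (D : 'M[C]_n) (k : R) (Z : par).

Definition defect i j := B i j - (if i == j then model (tau i) (r i) (D0 i) else 0).

Hypothesis tau01 : forall i, 0 <= tau i < 1.
Hypothesis ktr : forall i, k * (tau i * r i) = 1.
Hypothesis psi1 : \sum_i psi i * psi i = 1.
Hypothesis fixZ :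
  step psi tau defect k (rc k *: (D - \sum_i rc (psi i * psi i) *: D0 i)) Z = Z.

Lemma step_usub : usubmx Z = rc (- 2^-1) *: (Z^t* *m Z).
Proof. by rewrite -[in LHS]fixZ /step col_mxKu. Qed.

(** The upper block -Z^* Z / 2 is Hermitian, so adding its adjoint gives -Z^* Z and the obstruction
    in [stack_gram] vanishes for every weight at once. *)
Lemma step_isometry i : (stack (tau i) Z)^t* *m stack (tau i) Z = 1%:M.
Proof.
have /andP[t0 t1] := tau01 i.
rewrite stack_gram ?t0 ?ltW // step_usub trmxCZ trmxC_mul trmxCK conj_rc.
rewrite -scalerDl -rmorphD -{2}[Z^t* *m Z]scale1r -scalerDl -(rmorph1 (real_complex R)).
have -> : rc (- 2^-1 + - 2^-1) + rc 1 = 0; last by rewrite scale0r scaler0 addr0.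
by rewrite -rmorphD (_ : - 2^-1 + - 2^-1 + 1 = 0) ?rmorph0 //; lra.
Qed.

(** By [stack_model] the model at node i yields D0 i plus tau i * r i times the same matrix W for
    all i. As k * (tau i * r i) = 1 and the squared weights sum to 1, these multiples of W average,
    after multiplication by k, to exactly W. *)
Lemma residual_defect :
  rc k *: residual psi tau defect Z =
  rc k *: (\sum_i \sum_j rc (psi i * psi j) *:
     ((stack (tau j) Z)^t* *m B i j *m stack (tau i) Z)) -
  rc k *: (\sum_i rc (psi i * psi i) *: D0 i) - (1%:M + usubmx Z)^t* *m dsubmx Z.
Proof.
set W := (1%:M + usubmx Z)^t* *m dsubmx Z.
have -> : W = rc k *: \sum_i rc (psi i * psi i) *: (rc (tau i * r i) *: W).
  rewrite scaler_sumr -[LHS]scale1r -(rmorph1 (real_complex R)) -psi1 rmorph_sum scaler_suml.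
  by apply: eq_bigr => i _; rewrite !scalerA mulrAC -!rmorphM ktr mul1r.
rewrite -addrA -opprD -scalerDr -scalerBr -big_split; congr (_ *: _).
rewrite -sumrB; apply: eq_bigr => i _ /=.
rewrite -scalerDr -(stack_model (r i) (D0 i) Z (tau01 i)).
transitivity (\sum_j (rc (psi i * psi j) *: ((stack (tau j) Z)^t* *m B i j *m stack (tau i) Z) -
  if j == i then rc (psi i * psi i) *:
    ((stack (tau i) Z)^t* *m model (tau i) (r i) (D0 i) *m stack (tau i) Z) else 0)).
  apply: eq_bigr => j _; rewrite /defect eq_sym; case: eqP => [->|_].
    by rewrite mulmxBr mulmxBl scalerBr.
  by rewrite !subr0.
by rewrite sumrB -big_mkcond; congr (_ - _); apply: big_pred1_eq.
Qed.

(** With [residual_defect] inserted, the interpolated D0 and the quadratic term cancel, and the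
    lower block of the fixed point equation reduces to K = K + k (D - Q), where Q is the sum in
    question. *)
Lemma step_compression :
  \sum_i \sum_j rc (psi i * psi j) *:
     ((stack (tau j) Z)^t* *m B i j *m stack (tau i) Z) = D.
Proof.
(* An empty index type would contradict that the squared weights sum to 1, and for any i the
   relation k * (tau i * r i) = 1 excludes k = 0. *)
set Q := \sum_i _; have k0 : rc k != 0.
  have [i _|i0] := pickP (mem I).
    rewrite (inj_eq (@complexI R) k 0); apply/eqP => h.
    by have := ktr i; rewrite h mul0r => /eqP; rewrite eq_sym oner_eq0.
  by have := psi1; rewrite big1 => [/eqP|i]; rewrite ?[_ == 1]eq_sym ?oner_eq0 //; have := i0 i.
have := congr1 dsubmx fixZ; rewrite {1}/step col_mxKd residual_defect -/Q.
set Y := \sum_i _; rewrite trmxCD trmxC1 mulmxDl mul1mx scalerBr.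
set a := rc k *: D; set b := rc k *: Y; set c := rc k *: Q.
set s := (usubmx Z)^t* *m _; set K := dsubmx Z.
have -> : a - b - s - (c - b - (K + s)) = K + (a - c).
  exact: sub_cancel.
rewrite -[X in _ = X]addr0 => /addrI /eqP; rewrite subr_eq0 => /eqP h.
by apply: (scalerI k0); rewrite -[LHS]/c -h.
Qed.

End StepSolution.

(** * Dependence of the fixed point on the data *)

Section StepDependence.
Variables (R : realType) (n : nat) (I : finType).
Local Notation C := R[i].
Local Notation rc r := (real_complex R r).
Local Notation par := 'M[C]_(n + n, n).

Lemma residual_diff (psi psi' tau : I -> R)
    (E E' : I -> I -> 'M[C]_(n + (n + n))) (Z : par) :
  (forall i, 0 <= tau i <= 1) -> (forall i, 0 <= psi' i) -> mxnorm Z <= 8^-1 ->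
  mxnorm (residual psi tau E Z - residual psi' tau E' Z) <=
  \sum_i \sum_j (`|psi i * psi j - psi' i * psi' j| * (4 * mxnorm (E i j)) +
                 psi' i * psi' j * (4 * mxnorm (E i j - E' i j))).
Proof.
move=> t01 p0 hZ; have s2 i : mxnorm (stack (tau i) Z) <= 2 by apply: stack_le2.
rewrite /residual -sumrB; under eq_bigr do rewrite -sumrB.
apply: mxnorm_sum2 => i j.
set M := stack (tau i) Z; set M' := (stack (tau j) Z)^t*.
have -> : rc (psi i * psi j) *: (M' *m E i j *m M) - rc (psi' i * psi' j) *: (M' *m E' i j *m M) =
    rc (psi i * psi j - psi' i * psi' j) *: (M' *m E i j *m M) +
    rc (psi' i * psi' j) *: (M' *m (E i j - E' i j) *m M).
  by rewrite mulmxBr mulmxBl scalerBr rmorphB scalerBl addrA subrK.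
apply: le_trans (mxnormD _ _) _; apply: lerD; apply: le_trans (mxnormZr _ _) _.
  by rewrite ler_wpM2l //; apply: mxnorm_compress_le; apply: s2.
rewrite ger0_norm ?mulr_ge0 // ler_wpM2l ?mulr_ge0 //.
by apply: mxnorm_compress_le; apply: s2.
Qed.

(** Writing F and F' for the two maps, Z - Z' = (F Z - F Z') + (F Z' - F' Z'). The first bracket is
    at most half of the left side and is absorbed, which gives the factor 2; in the second the
    quadratic terms agree, and only G and the residual remain. *)
Lemma step_fixpoint_diff (psi psi' tau : I -> R)
    (E E' : I -> I -> 'M[C]_(n + (n + n))) (k eta : R) (G G' : 'M[C]_n) (Z Z' : par) :
  (forall i, 0 <= tau i <= 1) -> (forall i, 0 <= psi i) ->
  \sum_i \sum_j psi i * psi j * mxnorm (E i j) <= eta ->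
  0 <= k -> k * (4 * eta) <= 64^-1 ->
  mxnorm Z <= 8^-1 -> mxnorm Z' <= 8^-1 ->
  step psi tau E k G Z = Z -> step psi' tau E' k G' Z' = Z' ->
  mxnorm (Z - Z') <= 2 * (mxnorm (G - G') +
    k * mxnorm (residual psi tau E Z' - residual psi' tau E' Z')).
Proof.
move=> t01 p0 hE k0 hk hZ hZ' fZ fZ'.
have h1 := step_lip G t01 p0 hE k0 hk hZ hZ'; rewrite fZ in h1.
have h2 : mxnorm (step psi tau E k G Z' - Z') <= mxnorm (G - G') +
    k * mxnorm (residual psi tau E Z' - residual psi' tau E' Z').
  rewrite -[X in _ - X]fZ' /step opp_col_mx add_col_mx subrr.
  apply: le_trans (mxnorm_col _ _) _; rewrite mxnorm0 add0r.
  set s := _ *m _; have -> (V : zmodType) (g g' x y y' : V) :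
    g - x - y - (g' - x - y') = (g - g') - (y - y').
    rewrite !opprD !opprK addrACA; congr (_ + _).
    by rewrite addrACA [- x + x]addrC subrr addr0.
  rewrite -scalerBr; apply: le_trans (mxnormB _ _) _; rewrite lerD2l.
  by apply: le_trans (mxnormZr _ _) _; rewrite ger0_norm.
have h3 : mxnorm (Z - Z') <= mxnorm (Z - step psi tau E k G Z') +
    mxnorm (step psi tau E k G Z' - Z').
  by rewrite -{1}[Z](subrK (step psi tau E k G Z')) -addrA; apply: mxnormD.
lra.
Qed.

End StepDependence.

(** * Orthonormal bases of finite-dimensional spaces *)

Section OrthonormalBasis.
Variables (R : realType) (X : preHilbert R).
Local Notation C := R[i].

Definition coords m (e : 'I_m -> X) (x : X) : 'cV[C]_m := \col_i hdot x (e i).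

Lemma coords_lc m (e : 'I_m -> X) x : ortho_fam e -> coords e (lc e x) = x.
Proof.
move=> oe; apply/matrixP => i j; rewrite ord1 mxE hdot_suml (bigD1 i) //= big1.
  by rewrite hdotZ oe eqxx mulr1 addr0.
by move=> k ki; rewrite hdotZ oe (negbTE ki) mulr0.
Qed.

(** The family need not be independent: a vector already in the span of the previous ones is
    skipped, so the length m of the result is not tied to k. *)
Lemma gram_schmidt k (f : nat -> X) : exists m (e : 'I_m -> X),
  ortho_fam e /\ forall j, (j < k)%N -> exists c, f j = lc e c.
Proof.
elim: k => [|k [m [e [oe he]]]].
  by exists 0, (fun=> 0); split => // [[]].
pose y := f k - lc e (coords e (f k)).
have ye i : hdot y (e i) = 0.
  have := congr1 (fun v : 'cV_m => v i 0) (coords_lc (coords e (f k)) oe).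
  by rewrite !mxE /y hdotB => ->; rewrite subrr.
have [y0|y0] := eqVneq (hnorm y) 0.
  exists m, e; split => // j; rewrite ltnS leq_eqVlt => /orP[/eqP ->|]; last exact: he.
  by exists (coords e (f k)); apply/eqP; rewrite -subr_eq0 -/y (hnorm_eq0 y0).
pose z := real_complex R (hnorm y)^-1 *: y.
have yc : real_complex R (hnorm y) != 0 by rewrite (inj_eq (@complexI R) _ 0).
have z1 : hdot z z = 1.
  rewrite hdot_xx hnormZ cabs_real ger0_norm ?invr_ge0 ?hnorm_ge0 // mulVf //.
  by rewrite expr1n.
have ze i : hdot z (e i) = 0 by rewrite hdotZ ye mulr0.
pose e' (i : 'I_(m + 1)) := match fintype.split i with inl a => e a | inr _ => z end.
have el a : e' (lshift 1 a) = e a by rewrite /e' (unsplitK (inl a)).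
have er a : e' (rshift m a) = z by rewrite /e' (unsplitK (inr a)).
have lce c d : lc e' (col_mx c d) = lc e c + d 0 0 *: z.
  rewrite /lc big_split_ord /= big_ord1 col_mxEd er; congr (_ + _).
  by apply: eq_bigr => i _; rewrite col_mxEu el.
exists (m + 1)%N, e'; split.
  move=> a b; case: (fintype.splitP a) => a' ha; case: (fintype.splitP b) => b' hb.
  - have -> : a = lshift 1 a' by apply: val_inj.
    have -> : b = lshift 1 b' by apply: val_inj.
    by rewrite !el oe (inj_eq (@lshift_inj _ _)).
  - have -> : a = lshift 1 a' by apply: val_inj.
    have -> : b = rshift m b' by apply: val_inj.
    by rewrite el er hdotC ze conjC0 eq_lrshift.
  - have -> : a = rshift m a' by apply: val_inj.
    have -> : b = lshift 1 b' by apply: val_inj.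
    by rewrite el er ze eq_rlshift.
  - have -> : a = rshift m a' by apply: val_inj.
    have -> : b = rshift m b' by apply: val_inj.
    by rewrite !er z1 !ord1 eqxx.
move=> j; rewrite ltnS leq_eqVlt => /orP[/eqP ->|/he[c ->]].
  exists (col_mx (coords e (f k)) (real_complex R (hnorm y))%:M).
  rewrite lce mxE eqxx mulr1n /z scalerA fmorphV divff // scale1r.
  by rewrite /y addrC subrK.
by exists (col_mx c 0); rewrite lce mxE scale0r addr0.
Qed.

Lemma orthonormal_basis : finite_dim X -> exists m (e : 'I_m -> X),
  ortho_fam e /\ forall x, x = lc e (coords e x).
Proof.
(* The sum over i == j extends b from the ordinals below k to all of nat, with value 0 beyond k. *)
move=> [k [b hb]]; have [m [e [oe he]]] := gram_schmidt k (fun j => \sum_(i < k | i == j :> nat) b i).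
exists m, e; split => // x; have hbe i : exists c, b i = lc e c.
  by have [c hc] := he i (ltn_ord i); exists c; rewrite -hc (big_pred1 i).
have [c ->] : exists c, x = lc e c; last by rewrite coords_lc.
have [a ->] := hb x; elim/big_ind: _ => [|y z [c ->] [d ->]|i _].
- by exists 0; rewrite lc0.
- by exists (c + d); rewrite lcD.
- by have [c ->] := hbe i; exists (a i *: c); rewrite lcZ.
Qed.

End OrthonormalBasis.

(** * A partition of unity by squares on the grid *)

Section PartitionOfUnity.
Variable R : realType.

Definition clamp (y : R) : R := Num.min 1 (Num.max 0 y).

(** The tent function of height 1 centred at i/N, written as a difference of two consecutive ramps:
    the sum over the nodes then telescopes, with end values 1 and 0 on the unit interval. *)
Definition bump (N i : nat) (t : R) : R :=
  clamp (N%:R * t - i%:R + 1) - clamp (N%:R * t - i%:R).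

Lemma clamp_ge1 y : 1 <= y -> clamp y = 1.
Proof. by move=> h; rewrite /clamp max_r ?min_l // (le_trans ler01). Qed.

Lemma clamp_le0 y : y <= 0 -> clamp y = 0.
Proof. by move=> h; rewrite /clamp max_l // min_r. Qed.

Lemma clamp_mono x y : x <= y -> clamp x <= clamp y.
Proof. by move=> h; rewrite /clamp le_min2 ?le_max2. Qed.

Lemma clampP y : [\/ y <= 0 /\ clamp y = 0, (0 <= y /\ y <= 1) /\ clamp y = y
  | 1 <= y /\ clamp y = 1].
Proof.
have [y0|/ltW y0] := leP y 0; first by constructor 1; rewrite clamp_le0.
have [y1|/ltW y1] := leP y 1; last by constructor 3; rewrite clamp_ge1.
by constructor 2; rewrite /clamp max_r // min_r.
Qed.

Lemma clamp_lip x y : `|clamp x - clamp y| <= `|x - y|.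
Proof.
wlog xy : x y / x <= y => [h|].
  by case: (leP x y) => [|/ltW] /h // ; rewrite distrC [in leRHS]distrC.
rewrite !ler0_norm ?subr_le0 ?clamp_mono // !opprB.
by have [[? ->]|[[? ?] ->]|[? ->]] := clampP x; have [[? ->]|[[? ?] ->]|[? ->]] := clampP y; lra.
Qed.

Lemma bump_ge0 N i t : 0 <= bump N i t.
Proof. by rewrite subr_ge0 clamp_mono // lerDl. Qed.

Lemma bump_sum N t : @unit_interval R t -> \sum_(i < N.+1) bump N i t = 1.
Proof.
move=> /andP[t0 t1]; pose f (i : nat) : R := - clamp (N%:R * t - i%:R + 1).
rewrite -(big_mkord xpredT (fun i => bump N i t)).
have -> : \sum_(0 <= i < N.+1) bump N i t = \sum_(0 <= i < N.+1) (f i.+1 - f i).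
  apply: eq_bigr => i _; rewrite /f opprK [RHS]addrC /bump; congr (_ - clamp _).
  by rewrite -natr1 opprD addrA subrK.
have h : N%:R * t - N.+1%:R + 1 <= 0.
  by rewrite -natr1 opprD addrA subrK subr_le0 ler_piMr.
rewrite telescope_sumr // /f opprK (clamp_le0 h) oppr0 add0r clamp_ge1 //.
by rewrite addr0 lerDr mulr_ge0.
Qed.

Lemma bump_support N i t : (0 < N)%N -> bump N i t != 0 ->
  `|t - i%:R / N%:R| <= N%:R^-1.
Proof.
move=> N0 h; have Np : 0 < N%:R :> R by rewrite ltr0n.
rewrite -(ler_pM2r Np) mulVf ?gt_eqF // -[X in _ * X](gtr0_norm Np) -normrM.
rewrite mulrBl divfK ?gt_eqF // mulrC ler_norml.
apply: contraNT h; rewrite negb_and -!ltNge /bump => /orP[] h.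
  by rewrite !clamp_le0 ?subrr //; lra.
by rewrite !clamp_ge1 ?subrr //; lra.
Qed.

Definition weight (N i : nat) (t : R) : R := Num.sqrt (bump N i t).

Lemma weight_ge0 N i t : 0 <= weight N i t.
Proof. exact: sqrtr_ge0. Qed.

Lemma weight_sqr N i t : weight N i t * weight N i t = bump N i t.
Proof. by rewrite -expr2 sqr_sqrtr // bump_ge0. Qed.

Lemma bump_le1 N i t : bump N i t <= 1.
Proof.
rewrite lerBlDr /clamp; apply: (@le_trans _ _ 1); first by rewrite ge_min lexx.
by rewrite lerDl le_min ler01 le_max lexx.
Qed.

Lemma weight_le1 N i t : weight N i t <= 1.
Proof. by rewrite -sqrtr1 ler_wsqrtr // bump_le1. Qed.

Lemma sqrt_dist (a b : R) : 0 <= a -> 0 <= b ->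
  `|Num.sqrt a - Num.sqrt b| <= Num.sqrt `|a - b|.
Proof.
wlog ab : a b / b <= a => [h|a0 b0].
  case: (leP b a) => [|/ltW] hab a0 b0; first exact: h.
  by rewrite distrC [in leRHS]distrC h.
rewrite !ger0_norm ?subr_ge0 ?ler_wsqrtr //.
rewrite lerBlDr -(@ler_pXn2r _ 2) ?nnegrE ?addr_ge0 ?sqrtr_ge0 //.
rewrite sqrrD !sqr_sqrtr ?subr_ge0 //.
have : 0 <= Num.sqrt (a - b) * Num.sqrt b *+ 2 by rewrite mulrn_wge0 ?mulr_ge0 ?sqrtr_ge0.
lra.
Qed.

(** Each of the two ramps is N-Lipschitz, hence the 2N. The square root is not Lipschitz at 0, only
    Hölder of exponent 1/2, which is enough for a modulus of continuity. *)
Lemma weight_lip N i t t' :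
  `|weight N i t - weight N i t'| <= Num.sqrt (2 * N%:R * `|t - t'|).
Proof.
apply: le_trans (sqrt_dist (bump_ge0 _ _ _) (bump_ge0 _ _ _)) _.
rewrite ler_wsqrtr // /bump.
have -> (a b c d : R) : a - b - (c - d) = (a - c) - (b - d) by lra.
apply: le_trans (ler_normB _ _) _.
have h x : `|clamp (N%:R * t - i%:R + x) - clamp (N%:R * t' - i%:R + x)| <= N%:R * `|t - t'|.
  apply: le_trans (clamp_lip _ _) _.
  have -> : N%:R * t - i%:R + x - (N%:R * t' - i%:R + x) = N%:R * (t - t') by lra.
  by rewrite normrM ger0_norm.
have := h 1; have := h 0; rewrite !addr0; lra.
Qed.

Lemma weightM_dist N i j t t' :
  `|weight N i t * weight N j t - weight N i t' * weight N j t'| <=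
    2 * Num.sqrt (2 * N%:R * `|t - t'|).
Proof.
have h1 := weight_lip N i t t'; have h2 := weight_lip N j t t'.
have -> : weight N i t * weight N j t - weight N i t' * weight N j t' =
  (weight N i t - weight N i t') * weight N j t +
  weight N i t' * (weight N j t - weight N j t') by lra.
apply: le_trans (ler_normD _ _) _; rewrite !normrM.
rewrite (ger0_norm (weight_ge0 N j t)) (ger0_norm (weight_ge0 N i t')).
have -> : 2 * Num.sqrt (2 * N%:R * `|t - t'|) =
  Num.sqrt (2 * N%:R * `|t - t'|) * 1 + 1 * Num.sqrt (2 * N%:R * `|t - t'|) by lra.
by apply: lerD; apply: ler_pM; rewrite ?weight_ge0 ?weight_le1.
Qed.

Lemma weight_sum1 N t : @unit_interval R t ->
  \sum_(i < N.+1) weight N i t * weight N i t = 1.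
Proof. by move=> ti; under eq_bigr do rewrite weight_sqr; apply: bump_sum. Qed.

End PartitionOfUnity.

(** * Construction of the path of isometries and its estimates *)

Section Construction.
Variables (R : realType) (H X : preHilbert R) (A : R -> H -> H) (D : R -> X -> X).
Variables (theta : R) (N n : nat) (e : 'I_n -> X).
Local Notation C := R[i].
Local Notation rc r := (real_complex R r).
Local Notation I := 'I_N.+1.
Local Notation dA := (op_modulus A).
Local Notation dD := (op_modulus D).

Definition node (i : nat) : R := i%:R / N%:R.
Definition radius (i : I) : R := opnorm (D (node i)) + theta.
(** With this weight (1 - share i) * radius i exceeds the norm of D at the node by theta/2, which is
    the room that [target_le] uses. *)
Definition share (i : I) : R := theta / 2 / radius i.
Definition coef (t : R) : 'M[C]_n := comp_mx (D t) e e.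
Definition target (i : I) := model (share i) (radius i) (coef (node i)).

Hypotheses (cA : cont_op_path A) (cD : cont_op_path D) (th0 : 0 < theta) (N0 : (0 < N)%N).
Hypotheses (oe : ortho_fam e) (eE : forall x, x = lc e (coords e x)).

Lemma nodeI (i : I) : unit_interval (node i).
Proof. exact: unit_interval_node. Qed.

Lemma radius_gt0 i : 0 < radius i.
Proof. by rewrite ltr_wpDl // opnorm_ge0 //; apply: cont_op_path_bl (nodeI i). Qed.

Lemma share_radius i : share i * radius i = theta / 2.
Proof. by rewrite divfK // gt_eqF // radius_gt0. Qed.

Lemma share01 i : 0 <= share i < 1.
Proof.
have r0 := radius_gt0 i; apply/andP; split.
  by rewrite divr_ge0 ?divr_ge0 // ltW.
rewrite ltr_pdivrMr // mul1r /radius ltr_wpDl //.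
  by rewrite opnorm_ge0 //; apply: cont_op_path_bl (nodeI i).
by have := th0; lra.
Qed.

Lemma share_le1 i : 0 <= share i <= 1.
Proof. by have /andP[-> /ltW ->] := share01 i. Qed.

Lemma coef_le t : unit_interval t -> mxnorm (coef t) <= opnorm (D t).
Proof. by move=> ti; apply: mxnorm_comp => //; apply: cont_op_path_bl ti. Qed.

Lemma coef_dist t t' s : unit_interval t -> unit_interval t' -> `|t - t'| <= s ->
  mxnorm (coef t - coef t') <= dD s.
Proof.
move=> ti ti' ts; rewrite /coef -comp_mxB.
apply: le_trans (op_modulus_ub cD ti ti' ts).
by apply: mxnorm_comp => //; apply: cont_op_path_blB.
Qed.

Lemma target_le i : mxnorm (target i) <= radius i.
Proof.
have r0 := radius_gt0 i; apply: model_le; [exact: share01|exact: ltW|].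
apply: le_trans (coef_le (nodeI i)) _.
rewrite mulrBl mul1r share_radius /radius; have := th0; lra.
Qed.

Lemma coords_linear a x y : coords e (a *: x + y) = a *: coords e x + coords e y.
Proof. by apply/matrixP => i j; rewrite !mxE hdotDl. Qed.

Lemma cdot_coords x y : cdot (coords e x) (coords e y) = hdot x y.
Proof. by rewrite [in RHS](eE x) [in RHS](eE y) hdot_lc_ortho. Qed.

Lemma vnorm_coords x : vnorm (coords e x) = hnorm x.
Proof. by rewrite [in RHS](eE x) hnorm_lc. Qed.

Lemma hdot_coef t x y : unit_interval t ->
  hdot (D t x) y = cdot (coef t *m coords e x) (coords e y).
Proof.
move=> ti; rewrite -hdot_lc; last exact: cont_op_path_bl ti.
by rewrite -!eE.
Qed.

Variables (w : I -> 'I_(n + (n + n)) -> H) (ep : R).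
Definition cpr (t : R) (i j : I) := comp_mx (A t) (w i) (w j).

Hypothesis ow : forall i, ortho_fam (w i).
Hypothesis owij : forall (i j : I) a b, i != j -> hdot (w i a) (w j b) = 0.
Hypothesis wij : forall (i j : I) t, i != j -> unit_interval t -> mxnorm (cpr t i j) <= ep.
Hypothesis wii : forall i : I, mxnorm (cpr (node i) i i - target i) <= ep.
Hypothesis ep0 : 0 <= ep.
Hypothesis ep_small : (N.+1 * N.+1)%:R * ep <= theta / 2048.
Hypothesis dA_small : dA N%:R^-1 <= theta / 2048.
Hypothesis dD_small : dD N%:R^-1 <= theta / 2048.

Definition psi (t : R) (i : I) : R := weight N i t.
Definition err t := defect share radius (cpr t) (fun i => coef (node i)).
Definition gap t : 'M[C]_n :=
  rc (2 / theta) *: (coef t - \sum_i rc (psi t i * psi t i) *: coef (node i)).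

Lemma psi_ge0 t i : 0 <= psi t i. Proof. exact: weight_ge0. Qed.

Lemma psi_sum1 t : unit_interval t -> \sum_i psi t i * psi t i = 1.
Proof. exact: weight_sum1. Qed.

Lemma ep_le : ep <= theta.
Proof.
apply: le_trans (_ : _ <= theta / 2048) _; last by have := th0; lra.
by apply: le_trans ep_small; rewrite ler_peMl // ler1n.
Qed.

Lemma cpr_dist t t' s i j : unit_interval t -> unit_interval t' -> `|t - t'| <= s ->
  mxnorm (cpr t i j - cpr t' i j) <= dA s.
Proof.
move=> ti ti' ts; rewrite /cpr -comp_mxB.
apply: le_trans (op_modulus_ub cA ti ti' ts).
by apply: mxnorm_comp => //; apply: cont_op_path_blB.
Qed.

Lemma err_off t i j : unit_interval t -> i != j -> mxnorm (err t i j) <= ep.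
Proof. by move=> ti ij; rewrite /err /defect (negbTE ij) subr0; apply: wij. Qed.

Lemma err_diag t s (i : I) : unit_interval t -> `|t - node i| <= s ->
  mxnorm (err t i i) <= ep + dA s.
Proof.
move=> ti ts; rewrite /err /defect eqxx -[cpr t i i](subrK (cpr (node i) i i)).
rewrite -addrA addrC; apply: le_trans (mxnormD _ _) _; apply: lerD => //.
exact: cpr_dist ti (nodeI i) ts.
Qed.

Lemma dA_ge0 s : 0 <= s -> 0 <= dA s.
Proof. exact: (op_modulus_modulus cA).1. Qed.

Lemma dD_ge0 s : 0 <= s -> 0 <= dD s.
Proof. exact: (op_modulus_modulus cD).1. Qed.

Lemma unit_interval_dist t t' :
  @unit_interval R t -> unit_interval t' -> `|t - t'| <= 1.
Proof. by move=> /andP[? ?] /andP[? ?]; rewrite ler_norml; apply/andP; split; lra. Qed.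

(** A bound also for t far from the node. It is multiplied later by the change of the weights, so it
    need not be small, only free of the norm of A. *)
Lemma err_le t i j : unit_interval t -> mxnorm (err t i j) <= ep + dA 1.
Proof.
move=> ti; have [<-|ij] := eqVneq i j.
  by apply: err_diag => //; apply: unit_interval_dist => //; apply: nodeI.
by apply: le_trans (err_off ti ij) _; rewrite lerDl dA_ge0.
Qed.

(** The tolerance ep is paid for all (N+1)^2 pairs. The increment of A is paid only on the diagonal
    and only where the weight is nonzero, hence at distance at most 1/N; as the squared weights sum
    to 1, it costs theta/2048 once and not N+1 times. *)
Lemma err_sum t : unit_interval t ->
  \sum_i \sum_j psi t i * psi t j * mxnorm (err t i j) <= theta / 1024.
Proof.
move=> ti.
apply: (@le_trans _ _ (\sum_(i : I) \sum_(j : I) (ep + if j == i then psi t i * psi t i * (theta / 2048) else 0))).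
  apply: ler_sum => i _; apply: ler_sum => j _.
  have p1 : psi t i * psi t j <= 1.
    by rewrite mulr_ile1 ?weight_ge0 ?weight_le1.
  have p0 : 0 <= psi t i * psi t j by rewrite mulr_ge0 ?psi_ge0.
  have [->|ji] := eqVneq j i; last first.
    rewrite addr0; apply: le_trans (_ : _ <= mxnorm (err t i j)) _.
      by rewrite ler_piMl ?mxnorm_ge0.
    by apply: err_off => //; rewrite eq_sym.
  have [b0|b0] := eqVneq (bump N i t) 0.
    by rewrite /psi weight_sqr b0 !mul0r addr0.
  apply: le_trans (_ : _ <= psi t i * psi t i * (ep + theta / 2048)) _.
    rewrite ler_wpM2l ?mulr_ge0 ?psi_ge0 //.
    apply: le_trans (err_diag ti (bump_support N0 b0)) _.
    by rewrite lerD2l.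
  rewrite mulrDr lerD2r ler_piMl // mulr_ile1 ?weight_ge0 ?weight_le1 //.
under eq_bigr do rewrite big_split /= -big_mkcond big_pred1_eq.
rewrite big_split /= -mulr_suml psi_sum1 // mul1r.
rewrite !big_const_ord !iter_addr_0 -mulrnA -[_ *+ _]mulr_natl.
have := ep_small; lra.
Qed.

Lemma gapE t : unit_interval t ->
  coef t - \sum_i rc (psi t i * psi t i) *: coef (node i) =
  \sum_i rc (psi t i * psi t i) *: (coef t - coef (node i)).
Proof.
move=> ti; under [RHS]eq_bigr do rewrite scalerBr.
by rewrite sumrB -scaler_suml -rmorph_sum psi_sum1 // rmorph1 scale1r.
Qed.

Lemma gap_le t : unit_interval t -> mxnorm (gap t) <= 64^-1.
Proof.
move=> ti; rewrite /gap gapE //; apply: le_trans (mxnormZr _ _) _.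
have k0 : 0 <= 2 / theta by rewrite divr_ge0 // ltW.
rewrite ger0_norm //.
apply: (@le_trans _ _ (2 / theta * (theta / 2048))); last first.
  by rewrite mulrA divfK ?gt_eqF //; lra.
rewrite ler_wpM2l //; apply: le_trans (mxnorm_sum _ _ _) _.
apply: (@le_trans _ _ (\sum_i psi t i * psi t i * (theta / 2048))); last first.
  by rewrite -mulr_suml psi_sum1 // mul1r.
apply: ler_sum => i _; apply: le_trans (mxnormZr _ _) _.
rewrite ger0_norm ?mulr_ge0 ?psi_ge0 //.
have [b0|b0] := eqVneq (bump N i t) 0; first by rewrite /psi weight_sqr b0 !mul0r.
rewrite ler_wpM2l ?mulr_ge0 ?psi_ge0 //.
by apply: le_trans (coef_dist ti (nodeI i) (bump_support N0 b0)) _.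
Qed.

Lemma scale_eta : 2 / theta * (4 * (theta / 1024)) <= 64^-1.
Proof.
have -> : 2 / theta * (4 * (theta / 1024)) = 128^-1 by field; rewrite gt_eqF.
by lra.
Qed.

Lemma exists_parameter t : unit_interval t ->
  exists2 Z : 'M[C]_(n + n, n), mxnorm Z <= 8^-1 &
    step (psi t) share (err t) (2 / theta) (gap t) Z = Z.
Proof.
move=> ti; have k0 : 0 <= 2 / theta by rewrite divr_ge0 // ltW.
apply: mx_contraction_fixpoint; first by rewrite invr_ge0.
  move=> Z hZ.
  exact: (step_ball share_le1 (psi_ge0 t) (err_sum ti) k0 scale_eta (gap_le ti) hZ).
move=> Z Z' hZ hZ'.
exact: (step_lip _ share_le1 (psi_ge0 t) (err_sum ti) k0 scale_eta hZ hZ').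
Qed.

Definition root_dist (s : R) := Num.sqrt (2 * N%:R * s).

(** Since the squared weights sum to 1, the constant matrix [coef (node 0)] can be split off from
    the interpolation. What multiplies the change of the weights is then an increment of D, bounded
    by [dD 1], instead of D itself. *)
Lemma gap_dist t t' : unit_interval t -> unit_interval t' ->
  mxnorm (gap t - gap t') <= 2 / theta *
    (dD `|t - t'| + N.+1%:R * (2 * root_dist `|t - t'| * dD 1)).
Proof.
move=> ti ti'; have k0 : 0 <= 2 / theta by rewrite divr_ge0 // ltW.
rewrite /gap -scalerBr; apply: le_trans (mxnormZr _ _) _; rewrite ger0_norm //.
rewrite ler_wpM2l //.
have sumE s : unit_interval s -> \sum_i rc (psi s i * psi s i) *: coef (node i) =
    coef (node 0) + \sum_i rc (psi s i * psi s i) *: (coef (node i) - coef (node 0)).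
  move=> si; under [in RHS]eq_bigr do rewrite scalerBr.
  rewrite sumrB -scaler_suml -rmorph_sum psi_sum1 // rmorph1 scale1r.
  by rewrite addrC subrK.
rewrite (sumE t) // (sumE t') //.
have -> (V : zmodType) (a b c x y : V) : a - (c + x) - (b - (c + y)) = (a - b) - (x - y).
  rewrite !opprD !opprK addrACA; congr (_ + _).
  by rewrite addrACA addNr add0r.
apply: le_trans (mxnormB _ _) _; apply: lerD; first exact: coef_dist.
rewrite -sumrB; apply: le_trans (mxnorm_sum _ _ _) _.
apply: (@le_trans _ _ (\sum_(i : I) 2 * root_dist `|t - t'| * dD 1)); last first.
  by rewrite big_const_ord iter_addr_0 -[_ *+ _]mulr_natl.
apply: ler_sum => i _; rewrite -scalerBl -rmorphB.
apply: le_trans (mxnormZr _ _) _; apply: ler_pM; rewrite ?mxnorm_ge0 //.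
  exact: weightM_dist.
have n0 : @unit_interval R (node 0) by apply: (nodeI ord0).
by apply: coef_dist; rewrite ?unit_interval_dist //; apply: nodeI.
Qed.

(** The targets do not depend on t, so the change of [err] is an increment of A; the change of the
    weights meets the uniform bound [err_le]. *)
Lemma residual_dist t t' Z : unit_interval t -> unit_interval t' -> mxnorm Z <= 8^-1 ->
  mxnorm (residual (psi t) share (err t) Z - residual (psi t') share (err t') Z) <=
  (N.+1 * N.+1)%:R * (8 * root_dist `|t - t'| * (theta + dA 1) + 4 * dA `|t - t'|).
Proof.
move=> ti ti' hZ.
apply: le_trans (residual_diff _ _ _ share_le1 (psi_ge0 t') hZ) _.
apply: (@le_trans _ _ (\sum_(i : I) \sum_(j : I)
    (8 * root_dist `|t - t'| * (theta + dA 1) + 4 * dA `|t - t'|))); last first.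
  by rewrite !big_const_ord !iter_addr_0 -mulrnA -[_ *+ _]mulr_natl.
apply: ler_sum => i _; apply: ler_sum => j _; apply: lerD.
  have -> : 8 * root_dist `|t - t'| * (theta + dA 1) =
    2 * root_dist `|t - t'| * (4 * (theta + dA 1)) by lra.
  apply: ler_pM; rewrite ?mulr_ge0 ?mxnorm_ge0 //; first exact: weightM_dist.
  rewrite ler_wpM2l //; apply: le_trans (err_le _ _ ti) _.
  by rewrite lerD2r ep_le.
have -> : err t i j - err t' i j = cpr t i j - cpr t' i j.
  by rewrite /err /defect opprD opprK addrACA addNr addr0.
apply: le_trans (_ : _ <= 4 * mxnorm (cpr t i j - cpr t' i j)) _.
  rewrite ler_piMl ?mulr_ge0 ?mxnorm_ge0 // mulr_ile1 ?weight_ge0 ?weight_le1 //.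
by rewrite ler_wpM2l // cpr_dist.
Qed.

(** The number 32 = 2 * 2 * 8 is the largest coefficient met in [parameter_dist], in front of the
    change of the weights; it is used for all terms alike. *)
Definition drift (s : R) : R :=
  32 * (N.+1 * N.+1)%:R / theta * (dA s + dD s + root_dist s * (theta + dA 1 + dD 1)).

(** Any two fixed points in the ball are compared, however they were found; this is what makes a
    pointwise choice of parameters continuous. *)
Lemma parameter_dist t t' Z Z' : unit_interval t -> unit_interval t' ->
  mxnorm Z <= 8^-1 -> mxnorm Z' <= 8^-1 ->
  step (psi t) share (err t) (2 / theta) (gap t) Z = Z ->
  step (psi t') share (err t') (2 / theta) (gap t') Z' = Z' ->
  mxnorm (Z - Z') <= drift `|t - t'|.
Proof.
move=> ti ti' hZ hZ' fZ fZ'; have k0 : 0 <= 2 / theta by rewrite divr_ge0 // ltW.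
apply: le_trans (step_fixpoint_diff share_le1 (psi_ge0 t) (err_sum ti) k0 scale_eta hZ hZ' fZ fZ') _.
have s0 := normr_ge0 (t - t'); set s := `|t - t'| in s0 *.
apply: (@le_trans _ _ (2 * (2 / theta * (dD s + N.+1%:R * (2 * root_dist s * dD 1)) +
   2 / theta * ((N.+1 * N.+1)%:R * (8 * root_dist s * (theta + dA 1) + 4 * dA s))))).
  rewrite ler_wpM2l //; apply: lerD; first exact: gap_dist.
  by rewrite ler_wpM2l // residual_dist.
have v0 : 0 <= theta^-1 by rewrite invr_ge0 ltW.
have -> : 2 * (2 / theta * (dD s + N.+1%:R * (2 * root_dist s * dD 1)) +
   2 / theta * ((N.+1 * N.+1)%:R * (8 * root_dist s * (theta + dA 1) + 4 * dA s))) =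
  theta^-1 * (4 * (dD s + N.+1%:R * (2 * root_dist s * dD 1) +
   (N.+1 * N.+1)%:R * (8 * root_dist s * (theta + dA 1) + 4 * dA s))) by ring.
have -> : drift s = theta^-1 * (32 * (N.+1 * N.+1)%:R *
  (dA s + dD s + root_dist s * (theta + dA 1 + dD 1))) by rewrite /drift; ring.
rewrite ler_wpM2l // natrM.
have a0 := dA_ge0 s0; have b0 := dD_ge0 s0; have a1 := dA_ge0 ler01; have b1 := dD_ge0 ler01.
have r0 : 0 <= root_dist s by apply: sqrtr_ge0.
have q1 : 1 <= N.+1%:R :> R by rewrite ler1n.
have q2 : N.+1%:R <= N.+1%:R * N.+1%:R :> R by rewrite ler_peMl // (le_trans ler01).
have q3 : 1 <= N.+1%:R * N.+1%:R :> R by apply: le_trans q1 q2.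
move: (N.+1%:R * N.+1%:R) q2 q3 => q; move: (N.+1%:R : R) q1 => p p1 pq q1'.
have h1 : dD s <= q * dD s by rewrite ler_peMl.
have h2 : p * (root_dist s * dD 1) <= q * (root_dist s * dD 1).
  by rewrite ler_wpM2r ?mulr_ge0.
have q0 : 0 <= q by apply: le_trans ler01 q1'.
have h3 : 0 <= q * dA s by rewrite mulr_ge0.
have h4 : 0 <= q * (root_dist s * (theta + dA 1)).
  by rewrite !mulr_ge0 // addr_ge0 // ltW.
have h5 : 0 <= q * dD s by rewrite mulr_ge0.
have h6 : 0 <= q * (root_dist s * dD 1) by rewrite !mulr_ge0.
lra.
Qed.

Variable Zf : R -> 'M[C]_(n + n, n).
Hypothesis Zf_le : forall t, unit_interval t -> mxnorm (Zf t) <= 8^-1.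
Hypothesis Zf_fix : forall t, unit_interval t ->
  step (psi t) share (err t) (2 / theta) (gap t) (Zf t) = Zf t.

Definition isopath (t : R) (x : X) : H :=
  \sum_i rc (psi t i) *: lc (w i) (stack (share i) (Zf t) *m coords e x).

Lemma isopath_linear t a x y : isopath t (a *: x + y) = a *: isopath t x + isopath t y.
Proof.
rewrite /isopath scaler_sumr -big_split; apply: eq_bigr => i _ /=.
rewrite coords_linear mulmxDr -scalemxAr lcDl scalerDr; congr (_ + _).
by rewrite !scalerA mulrC.
Qed.

Lemma k_share i : 2 / theta * (share i * radius i) = 1.
Proof. by rewrite share_radius; field; rewrite gt_eqF. Qed.

Lemma hdot_isopath T t x y : bounded_linear T ->
  hdot (T (isopath t x)) (isopath t y) =
  \sum_i \sum_j rc (psi t i * psi t j) *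
    cdot (comp_mx T (w i) (w j) *m (stack (share i) (Zf t) *m coords e x))
         (stack (share j) (Zf t) *m coords e y).
Proof.
move=> bT; rewrite (bounded_linear_sum _ _ _ bT) hdot_suml; apply: eq_bigr => i _.
rewrite hdot_sumr; apply: eq_bigr => j _.
by rewrite (bounded_linearZ _ _ bT) hdotZ hdotZr hdot_lc // conj_rc rmorphM mulrA.
Qed.

Lemma isopath_isometry t : unit_interval t -> is_isometry (isopath t).
Proof.
move=> ti x y; rewrite (hdot_isopath _ _ _ (@bounded_linear_id _ H)).
transitivity (\sum_i rc (psi t i * psi t i) * hdot x y); last first.
  by rewrite -mulr_suml -rmorph_sum psi_sum1 // rmorph1 mul1r.
apply: eq_bigr => i _; rewrite (bigD1 i) //= big1 => [|j ji].
  rewrite addr0; congr (_ * _); rewrite -cdot_coords -hdot_lc; last exact: bounded_linear_id.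
  rewrite hdot_lc_ortho // cdot_isom //.
  exact: (step_isometry share01 (Zf_fix ti)).
have -> : comp_mx (fun x : H => x) (w i) (w j) = 0; last first.
  by rewrite mul0mx -[cdot _ _]/(hdot (0 : Cn R _) _) hdot0l mulr0.
by apply/matrixP => a b; rewrite !mxE owij // eq_sym.
Qed.

Lemma isopath_compression t x y : unit_interval t ->
  hdot (A t (isopath t x)) (isopath t y) = hdot (D t x) y.
Proof.
move=> ti; rewrite (hdot_isopath _ _ _ (cont_op_path_bl cA ti)) hdot_coef //.
rewrite -(step_compression share01 k_share (psi_sum1 ti) (Zf_fix ti)).
rewrite mulmx_suml [RHS](@hdot_suml _ (Cn R n)); apply: eq_bigr => i _.
rewrite mulmx_suml [RHS](@hdot_suml _ (Cn R n)); apply: eq_bigr => j _.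
rewrite -scalemxAl [RHS](@hdotZ _ (Cn R n)); congr (_ * _).
by rewrite -[RHS]/(cdot _ _) -!mulmxA [RHS]cdot_adj trmxCK.
Qed.

Lemma isopath_in (L : set H) t x : closed_subspace L -> (forall i a, L (w i a)) ->
  L (isopath t x).
Proof.
move=> [L0 [LD [LZ _]]] Lw; rewrite /isopath /lc.
apply: (big_ind L) => // i _; apply: (LZ).
by apply: (big_ind L) => // a _; apply: LZ.
Qed.

(** Each node contributes the change of its weight times the bound 2 for the stack, and the change
    of the parameter; the coordinate maps into H are isometric and do not depend on t. *)
Lemma isopath_dist t t' x : unit_interval t -> unit_interval t' ->
  hnorm (isopath t x - isopath t' x) <=
    N.+1%:R * (2 * root_dist `|t - t'| + drift `|t - t'|) * hnorm x.
Proof.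
move=> ti ti'; rewrite /isopath -sumrB; apply: le_trans (hnorm_sum _ _ _) _.
apply: (@le_trans _ _ (\sum_(i : I) (2 * root_dist `|t - t'| + drift `|t - t'|) * hnorm x)); last first.
  by rewrite big_const_ord iter_addr_0 -[_ *+ _]mulr_natl mulrA.
apply: ler_sum => i _.
set M := stack _ (Zf t); set M' := stack _ (Zf t').
have -> : rc (psi t i) *: lc (w i) (M *m coords e x) - rc (psi t' i) *: lc (w i) (M' *m coords e x) =
    rc (psi t i - psi t' i) *: lc (w i) (M *m coords e x) +
    rc (psi t' i) *: lc (w i) ((M - M') *m coords e x).
  by rewrite mulmxBl lcB scalerBr rmorphB scalerBl addrA subrK.
apply: le_trans (hnormD _ _) _; rewrite mulrDl; apply: lerD.
  rewrite hnormZ cabs_real hnorm_lc // [2 * _]mulrC -mulrA.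
  apply: ler_pM; rewrite ?vnorm_ge0 //; first exact: weight_lip.
  apply: le_trans (mulmx_ub _ _) _; rewrite vnorm_coords ler_wpM2r ?hnorm_ge0 //.
  by apply: stack_le2; [exact: share_le1 | exact: Zf_le].
rewrite hnormZ cabs_real hnorm_lc // ger0_norm ?psi_ge0 //.
apply: le_trans (_ : _ <= vnorm ((M - M') *m coords e x)) _.
  by rewrite ler_piMl ?vnorm_ge0 // weight_le1.
apply: le_trans (mulmx_ub _ _) _; rewrite vnorm_coords ler_wpM2r ?hnorm_ge0 //.
apply: le_trans (stackB _ _ (share_le1 i)) _.
by apply: parameter_dist; rewrite ?Zf_le ?Zf_fix.
Qed.

End Construction.

(** * The modulus as a function of theta and the two given moduli *)

Section Modulus.
Variable R : realType.

(** The bound of [isopath_dist], with arbitrary functions f and g in place of the moduli of A and D: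
    the recipe has to be fixed before any operator is given. *)
Definition path_modulus (N : nat) (theta : R) (f g : R -> R) (s : R) : R :=
  N.+1%:R * (2 * root_dist N s + 32 * (N.+1 * N.+1)%:R / theta *
    (f s + g s + root_dist N s * (theta + f 1 + g 1))).

Lemma path_modulusP N theta f g : 0 < theta ->
  modulus_of_continuity f -> modulus_of_continuity g ->
  modulus_of_continuity (path_modulus N theta f g).
Proof.
move=> th0 [f0 [fm [fz fc]]] [g0 [gm [gz gc]]].
have r0 s : 0 <= root_dist N s :> R by apply: sqrtr_ge0.
pose c : R := N.+1%:R * (2 + 32 * (N.+1 * N.+1)%:R / theta * (1 + (theta + f 1 + g 1))).
have k0 : 0 <= 32 * (N.+1 * N.+1)%:R / theta :> R by rewrite divr_ge0 ?mulr_ge0 // ltW.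
have c0 : 0 <= theta + f 1 + g 1 by rewrite !addr_ge0 ?f0 ?g0 // ltW.
split; last split; last split.
- move=> s s0; apply: mulr_ge0 => //; apply: addr_ge0; first exact: mulr_ge0.
  apply: mulr_ge0 => //; apply: addr_ge0; last exact: mulr_ge0.
  by rewrite addr_ge0 ?f0 ?g0.
- move=> s s' s0 ss'; have rs : root_dist N s <= root_dist N s' :> R.
    by rewrite ler_wsqrtr // ler_wpM2l // mulr_ge0.
  rewrite ler_wpM2l //; apply: lerD; first by rewrite ler_wpM2l.
  rewrite ler_wpM2l //; apply: lerD; first by apply: lerD; [apply: fm | apply: gm].
  by rewrite ler_wpM2r.
- by rewrite /path_modulus /root_dist mulr0 sqrtr0 fz gz mul0r !addr0 !mulr0 addr0 mulr0.
- move=> e e0; have c1 : 0 < c.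
    rewrite /c mulr_gt0 ?ltr0n // ltr_pwDl // mulr_ge0 // addr_ge0 //.
  pose q := e / (3 * c); have q0 : 0 < q by rewrite divr_gt0 // mulr_gt0.
  have [d1 d10 h1] := fc _ q0; have [d2 d20 h2] := gc _ q0.
  (* Chosen so that [root_dist N s] stays below q for s below d3; the successor covers the case N =
     0. *)
  pose d3 := q ^+ 2 / (2 * N.+1%:R).
  have d30 : 0 < d3 by rewrite divr_gt0 ?exprn_gt0 // mulr_gt0 ?ltr0n.
  exists (Num.min d1 (Num.min d2 d3)); first by rewrite !lt_min d10 d20 d30.
  move=> s s0; rewrite !lt_min => /and3P[sd1 sd2 sd3].
  have hf := h1 s s0 sd1; have hg := h2 s s0 sd2.
  have hr : root_dist N s < q.
    rewrite -[ltRHS]ger0_norm 1?ltW // -sqrtr_sqr ltr_sqrt ?exprn_gt0 //.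
    apply: (@le_lt_trans _ _ (2 * N.+1%:R * s)).
      by rewrite ler_wpM2r ?(ltW s0) // ler_wpM2l // ler_nat.
    by rewrite mulrC -ltr_pdivlMr // mulr_gt0 ?ltr0n.
  apply: (@le_lt_trans _ _ (c * (f s + g s + root_dist N s))).
    rewrite /path_modulus /c -[leRHS]mulrA ler_wpM2l //.
    set kk := 32 * _ / _ in k0 *.
    have a1 := f0 s (ltW s0); have a2 := g0 s (ltW s0); have a3 := r0 s.
    set C0 := theta + f 1 + g 1 in c0 *.
    have b1 : 0 <= kk * (C0 * (f s + g s)).
      by apply: mulr_ge0 => //; apply: mulr_ge0 => //; apply: addr_ge0.
    have b2 : 0 <= kk * root_dist N s by rewrite mulr_ge0.
    lra.
  have -> : e = c * (q + q + q).
    by rewrite /q; field; rewrite gt_eqF.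
  by rewrite ltr_pM2l // !ltrD.
Qed.

(** A choice that depends on theta, f and g alone, so that equal moduli give the same grid for all
    operators. The value 0 stands for the case that no N qualifies, excluded by [grid_sizeP] for
    moduli. *)
Definition grid_size (theta : R) (f g : R -> R) : nat :=
  xget 0 [set N | (0 < N)%N /\ f N%:R^-1 <= theta / 2048 /\ g N%:R^-1 <= theta / 2048].

Lemma grid_sizeP theta f g : 0 < theta ->
  modulus_of_continuity f -> modulus_of_continuity g ->
  let N := grid_size theta f g in
  (0 < N)%N /\ f N%:R^-1 <= theta / 2048 /\ g N%:R^-1 <= theta / 2048.
Proof.
move=> th0 [_ [_ [_ fc]]] [_ [_ [_ gc]]] N; apply: (@xgetPex _ 0
  [set N | (0 < N)%N /\ f N%:R^-1 <= theta / 2048 /\ g N%:R^-1 <= theta / 2048]).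
have t0 : 0 < theta / 2048 by rewrite divr_gt0.
have [d1 d10 h1] := fc _ t0; have [d2 d20 h2] := gc _ t0.
have [|M M0 hM] := @inv_nat_lt _ (Num.min d1 d2); first by rewrite lt_min d10.
move: hM; rewrite lt_min => /andP[m1 m2].
have v0 : 0 < M%:R^-1 :> R by rewrite invr_gt0 ltr0n.
by exists M; split => //; split; rewrite ltW //; [apply: h1 | apply: h2].
Qed.

End Modulus.

(** * Assembly: grid, tolerance, blocks in L, and parameters *)

Theorem theorem4p4 (R : realType) :
  exists Phi : R -> (R -> R) -> (R -> R) -> (R -> R),
  forall (H X : preHilbert R) (A : R -> H -> H) (D : R -> X -> X) (theta : R),
    complete H -> separable H -> ~ finite_dim H ->
    complete X -> finite_dim X ->
    cont_op_path A -> cont_op_path D -> 0 < theta ->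
    (forall t, unit_interval t -> forall z : R[i],
       `|z| <= ((opnorm (D t) + theta)%:C)%C -> ess_num_range (A t) z) ->
    let delta := Phi theta (op_modulus A) (op_modulus D) in
    modulus_of_continuity delta /\
    forall L : set H, closed_subspace L -> finite_codim L ->
      exists V : R -> X -> H,
        cont_op_path V /\
        (forall t, unit_interval t -> is_isometry (V t)) /\
        Zspan V `<=` L /\
        (forall t t', unit_interval t -> unit_interval t' ->
           opnorm (fun x => V t x - V t' x) <= delta `|t - t'|) /\
        (forall t, unit_interval t -> forall x y : X,
           hdot (A t (V t x)) (V t y) = hdot (D t x) y).
Proof.
exists (fun theta f g => path_modulus (grid_size theta f g) theta f g).
move=> H X A D theta _ _ _ _ finX cA cD th0 hW delta.
have mA := op_modulus_modulus cA; have mD := op_modulus_modulus cD.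
have mdelta : modulus_of_continuity delta by apply: path_modulusP.
split => // L clL fL.
have [N0 [dA_small dD_small]] := grid_sizeP th0 mA mD.
set N := grid_size _ _ _ in N0 dA_small dD_small.
have [n [e [oe eE]]] := orthonormal_basis finX.
pose m := (n + (n + n))%N.
(* The tolerance is fixed after the dimension and the grid: c offsets the number of pairs of nodes
   and the number of entries of a block. The successor keeps c positive when X is zero and hence m =
   0. *)
pose c : R := ((N.+1 * N.+1)%:R * ((m + m) * (m + m)).+1%:R)^-1.
have c0 : 0 < c by rewrite invr_gt0 mulr_gt0 // ltr0n.
pose eps := theta / 2048 * c.
have eps0 : 0 < eps by rewrite mulr_gt0 // divr_gt0.
pose ep := eps * ((m + m) * (m + m))%:R.
have ep0 : 0 <= ep by rewrite mulr_ge0 // ltW.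
have ep_small : (N.+1 * N.+1)%:R * ep <= theta / 2048.
  have q0 : 0 < (N.+1 * N.+1)%:R :> R by rewrite ltr0n.
  have p0 : 0 < ((m + m) * (m + m)).+1%:R :> R by rewrite ltr0n.
  apply: (@le_trans _ _ ((N.+1 * N.+1)%:R * (eps * ((m + m) * (m + m)).+1%:R))).
    by rewrite ler_wpM2l ?(ltW q0) // ler_wpM2l ?(ltW eps0) // ler_nat.
  rewrite /eps /c le_eqVlt; apply/orP; left; apply/eqP.
  rewrite -mulrA [_^-1 * _]mulrC invfM mulrCA [_ * (_ / _)]mulrCA.
  by rewrite divff ?gt_eqF // mulr1 divff ?gt_eqF // mulr1.
have hT (i : 'I_N.+1) : [/\ unit_interval (node R N i), 0 < radius D theta i,
    mxnorm (target D theta e i) <= radius D theta i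
  & forall z : R[i], `|z| <= real_complex R (radius D theta i) ->
      ess_num_range (A (node R N i)) z].
  have ti := nodeI R N0 i; split => //; first exact: radius_gt0.
    exact: target_le.
  by move=> z; apply: hW.
(* The subspace L enters through these vectors, of which the estimates leave no trace in delta. *)
have [w [Lw ow owij wij wii]] := select_blocks cA clL fL eps0 hT.
have /choice[Zf hZ] : forall t, exists Z : 'M[R[i]]_(n + n, n), unit_interval t ->
    mxnorm Z <= 8^-1 /\
    step (@psi R N t) (@share R X D theta N) (err A D theta e w t) (2 / theta) (gap D theta N e t) Z = Z.
  (* The parameter 0 outside the unit interval is a dummy value. *)
  move=> t; have [ti|nti] := pselect (unit_interval t); last by exists 0.
  by have [Z ? ?] := exists_parameter cA cD th0 N0 oe ow wij wii ep0 ep_small dA_small dD_small ti; exists Z.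
have Zle t : unit_interval t -> mxnorm (Zf t) <= 8^-1 by move=> /hZ[].
have Zfix t : unit_interval t -> step (@psi R N t) (@share R X D theta N) (err A D theta e w t)
    (2 / theta) (gap D theta N e t) (Zf t) = Zf t by move=> /hZ[].
pose V := isopath D theta e w Zf.
have isoV t : unit_interval t -> is_isometry (V t).
  by move=> ti; exact: (isopath_isometry cD th0 N0 oe eE ow owij Zfix ti).
have distV t t' x : unit_interval t -> unit_interval t' ->
    hnorm (V t x - V t' x) <= delta `|t - t'| * hnorm x.
  by move=> ti ti'; exact: (isopath_dist cA cD th0 N0 oe eE ow wij wii ep0 ep_small dA_small Zle Zfix x ti ti').
have modV t t' : unit_interval t -> unit_interval t' ->
    opnorm (fun x => V t x - V t' x) <= delta `|t - t'|.
  by move=> ti ti'; apply: opnorm_le => [x|]; [apply: distV | apply: mdelta.1].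
exists V; split; last split; last split; last split => //.
- split=> [t ti|t ti eta eta0].
    split; first by move=> a x y; apply: isopath_linear.
    exists 1 => x; rewrite mul1r /hnorm (isoV t ti) //.
  have [_ [_ [d0 dc]]] := mdelta; have [d dgt hd] := dc _ eta0.
  exists d => // t' ti' tt'; apply: le_lt_trans (modV t t' ti ti') _.
  (* Smallness of delta near 0 is available only for positive arguments, so t = t' is settled by
     delta 0 = 0. *)
  have := normr_ge0 (t - t'); rewrite le_eqVlt => /orP[/eqP <-|h]; first by rewrite d0.
  exact: hd.
- exact: isoV.
(* The closed span lies in every closed subspace containing the ranges, and L is one of these. *)
- move=> h; apply => // _ [t ti [x _ <-]]; exact: (isopath_in D theta e Zf t x clL Lw).
- by move=> t ti x y; exact: (isopath_compression cA cD th0 N0 eE Zfix x y ti).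
Qed.
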